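(* Let $\mathcal{GW}(\{q_k\})$ be a critical or subcritical Galton-Watson measure on $\mathcal{T}^|$ with $q_1=0$, and assume that the limit $S'(1)=\lim_{x\to 1-}\frac{1-S(x)}{1-x}$ exists. Then $\mathcal{GW}(\{q_k\})$ is Horton prune-invariant if and only if it is the invariant Galton-Watson measure $\mathcal{IGW}(q_0)$ with $q_0\in[1/2,1)$.
   Context: Trees. $\mathcal{T}^|$ denotes the set of finite unlabeled rooted trees that are planted (either the empty tree $\phi$ consisting of the root only, or the root has exactly one offspring) and reduced (no vertex of degree $2$; the degree of a non-root vertex is its number of offspring plus one). Galton-Watson measures. For a probability distribution $\{q_k\}_{k\ge 0}$ with $q_1=0$, $\mathcal{GW}(\{q_k\})$ is the law of the random tree whose root has a single offspring and in which every non-root vertex independently has $k$ offspring with probability $q_k$. It is critical if $\sum_k kq_k=1$ and subcritical if $\sum_k kq_k<1$; in these cases it is a probability measure on $\mathcal{T}^|$ giving mass zero to $\phi$. Let $Q(z)=\sum_{m\ge 0}q_mz^m$ and $S(z)=\frac{Q(z)-zQ'(z)}{1-Q'(z)}$ for $z\in[0,1)$. Horton pruning. $\mathcal{R}(T)$ for $T\neq\phi$ is obtained from $T$ by removing all leaves together with their parental edges, followed by series reduction (removing each non-root vertex of degree $2$ and merging its two adjacent edges into one); $\mathcal{R}(\phi)=\phi$. For a measure $\mu$ with $\mu(\phi)=0$, let $\nu(T)=\mu(\mathcal{R}^{-1}(T))$. The measure $\mu$ is called Horton prune-invariant (Horton self-similar) if $\nu(T\mid T\neq\phi)=\mu(T)$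 for every $T\in\mathcal{T}^|$ (in particular, $\nu(T\ne\phi)>0$). Invariant Galton-Watson measures. For $q\in[1/2,1)$, $\mathcal{IGW}(q)$ is the critical Galton-Watson measure whose offspring generating function is $Q(z)=z+q(1-z)^{1/q}$; equivalently $q_0=q$, $q_1=0$, $q_2=(1-q)/(2q)$ and $q_k=\frac{1-q}{k!\,q}\prod_{i=2}^{k-1}(i-1/q)$ for $k\ge 3$. *)

(* Defs.v *)
From HB Require Import structures.
From mathcomp Require Import all_boot all_order all_algebra.
From mathcomp Require Import generic_quotient.
From mathcomp Require Import all_classical all_reals all_analysis.

Set Implicit Arguments.
Unset Strict Implicit.
Unset Printing Implicit Defensive.

Import Order.TTheory GRing.Theory Num.Theory.
Import numFieldNormedType.Exports.

Local Open Scope classical_set_scope.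
Local Open Scope ring_scope.
Local Open Scope quotient_scope.

(* Finite rooted plane trees, [Node s] being a vertex whose offspring subtrees
   are listed from left to right in [s].  The topmost vertex is the root.
   Unlabeled trees are obtained below by forgetting the order of offspring. *)
Inductive rtree := Node of seq rtree.

Definition children (t : rtree) : seq rtree := let: Node s := t in s.

Fixpoint rtree_all_ind (P : rtree -> Prop)
    (IH : forall s, foldr (fun u => and (P u)) True s -> P (Node s))
    (t : rtree) : P t :=
  let: Node s := t in
  IH s ((fix loop (l : seq rtree) : foldr (fun u => and (P u)) True l :=
    if l is u :: l' then conj (rtree_all_ind IH u) (loop l') else I) s).

Fixpoint rtree_encode (t : rtree) : GenTree.tree unit :=
  let: Node s := t in GenTree.Node 0 [seq rtree_encode u | u <- s].

Fixpoint rtree_decode (t : GenTree.tree unit) : rtree :=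
  if t is GenTree.Node _ s then Node [seq rtree_decode u | u <- s]
  else Node [::].

Lemma rtree_encodeK : cancel rtree_encode rtree_decode.
Proof.
elim/rtree_all_ind => s /= Hs; congr Node.
by elim: s Hs => //= u l IHl [-> /IHl ->].
Qed.

HB.instance Definition _ := Countable.copy rtree (can_type rtree_encodeK).

(* [no_unary t]: no vertex of [t], its topmost vertex included, has exactly one
   offspring.  A non-root vertex has degree 2 iff it has exactly one
   offspring. *)
Fixpoint no_unary (t : rtree) : bool :=
  let: Node s := t in (size s != 1%N) && all no_unary s.

Definition planted (t : rtree) : bool := (size (children t) <= 1)%N.

Definition reduced (t : rtree) : bool := all no_unary (children t).

(* The equivalence generated by reordering the offspring of a vertex. *)
Inductive reordering : rtree -> rtree -> Prop :=
| reordering_refl t : reordering t t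
| reordering_sym t u : reordering t u -> reordering u t
| reordering_trans u t v :
    reordering t u -> reordering u v -> reordering t v
| reordering_perm s s' : perm_eq s s' -> reordering (Node s) (Node s')
| reordering_sub s1 t t' s2 : reordering t t' ->
    reordering (Node (s1 ++ t :: s2)) (Node (s1 ++ t' :: s2)).

Definition plane_tree := {t : rtree | planted t && reduced t}.

Definition same_tree (t u : plane_tree) : bool :=
  `[< reordering (val t) (val u) >].

Lemma same_tree_is_equiv : equiv_class_of same_tree.
Proof.
split=> [t|t u|t u v].
- by apply/asboolP; exact: reordering_refl.
- by apply/asboolP/asboolP; exact: reordering_sym.
- move=> /asboolP tu /asboolP uv; apply/asboolP; exact: reordering_trans uv.
Qed.

Canonical same_tree_equiv := EquivRelPack same_tree_is_equiv.

(* The set of finite unlabeled rooted planted reduced trees. *)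
Definition tree := {eq_quot same_tree}.

HB.instance Definition _ := Choice.on tree.
HB.instance Definition _ := EqQuotient.on tree.

Definition plane_phi : plane_tree := exist _ (Node [::]) isT.

Definition phi : tree := \pi_tree plane_phi.

HB.instance Definition _ := isPointed.Build tree phi.

HB.instance Definition _ := @isMeasurable.Build default_measure_display tree
  discrete_measurable discrete_measurable0
  discrete_measurableC discrete_measurableU.

Definition is_leaf (t : rtree) : bool := nilp (children t).

(* The leaves other than the topmost vertex are removed; vertices which become
   childless in the process are kept. *)
Fixpoint cut_leaves (t : rtree) : rtree :=
  let: Node s := t in
  Node (pmap (fun u => if is_leaf u then None else Some (cut_leaves u)) s).

(* Here [t] hangs below a parental edge: a vertex with a single offspring is
   deleted and its offspring takes its place. *)
Fixpoint contract (t : rtree) : rtree :=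
  let: Node s := t in
  if [seq contract u | u <- s] is [:: u] then u
  else Node [seq contract u | u <- s].

(* The root itself is never removed. *)
Definition series_reduction (t : rtree) : rtree :=
  Node [seq contract u | u <- children t].

Definition prune (t : rtree) : rtree := series_reduction (cut_leaves t).

Lemma no_unary_contract t : no_unary (contract t).
Proof.
elim/rtree_all_ind: t => s Hs /=.
have Hall : all no_unary [seq contract u | u <- s].
  by elim: s Hs => //= u l IHl [-> /IHl ->].
case E: [seq contract u | u <- s] Hall => [|u [|v l]] //=.
by rewrite andbT.
Qed.

Lemma prune_subproof (t : rtree) :
  planted t && reduced t -> planted (prune t) && reduced (prune t).
Proof.
case: t => s /andP[pl _]; apply/andP; split.
  rewrite /planted /= size_map size_pmap.
  exact: leq_trans (count_size _ _) pl.
rewrite /reduced /=; apply/allP => u /mapP[v _ ->].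
exact: no_unary_contract.
Qed.

Definition plane_prune (t : plane_tree) : plane_tree :=
  exist _ (prune (val t)) (prune_subproof (valP t)).

Definition horton_prune (t : tree) : tree := \pi_tree (plane_prune (repr t)).

Lemma reordering_size t u :
  reordering t u -> size (children t) = size (children u).
Proof.
elim=> {t u} //=.
- by move=> u t v _ -> _ ->.
- by move=> s s' /perm_size.
- by move=> s1 t t' s2 _ _; rewrite !size_cat.
Qed.

Lemma reordering_cut t u :
  reordering t u -> reordering (cut_leaves t) (cut_leaves u).
Proof.
elim=> {t u} /=.
- by move=> t; exact: reordering_refl.
- by move=> t u _; exact: reordering_sym.
- by move=> u t v _ + _; exact: reordering_trans.
- by move=> s s' ss'; apply: reordering_perm; exact: perm_pmap.
- move=> s1 t t' s2 tt' IH; rewrite !pmap_cat /=.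
  have -> : is_leaf t = is_leaf t'.
    by rewrite /is_leaf /nilp (reordering_size tt').
  by case: ifP => _ /=; [exact: reordering_refl|exact: reordering_sub].
Qed.

Lemma reordering_contract t u :
  reordering t u -> reordering (contract t) (contract u).
Proof.
elim=> {t u}.
- by move=> t; exact: reordering_refl.
- by move=> t u _; exact: reordering_sym.
- by move=> u t v _ + _; exact: reordering_trans.
- move=> s s' /(perm_map contract) /= ss'.
  have := perm_size ss'.
  case: [seq contract u | u <- s] ss' => [|a [|b l]];
  case: [seq contract u | u <- s'] => [|a' [|b' l']] //= ss' _.
  + exact: reordering_refl.
  + have := perm_mem ss' a; rewrite !inE eqxx => /esym/eqP ->.
    exact: reordering_refl.
  + exact: reordering_perm.
- move=> s1 t t' s2 _ IH /=; rewrite !map_cat /=.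
  case: [seq contract u | u <- s1] => [|a [|b l]] /=;
  case: [seq contract u | u <- s2] => [|a' [|b' l']] //=;
  first [exact: (@reordering_sub [::])
        | exact: (@reordering_sub [:: a])
        | exact: (@reordering_sub [:: a, b & l])].
Qed.

Lemma reordering_series_reduction t u :
  reordering t u -> reordering (series_reduction t) (series_reduction u).
Proof.
elim=> {t u}.
- by move=> t; exact: reordering_refl.
- by move=> t u _; exact: reordering_sym.
- by move=> u t v _ + _; exact: reordering_trans.
- by move=> s s' ss'; apply: reordering_perm; exact: perm_map.
- move=> s1 t t' s2 tt' _; rewrite /series_reduction /= !map_cat /=.
  by apply: reordering_sub; exact: reordering_contract.
Qed.

Lemma horton_prune_pi (t : plane_tree) :
  horton_prune (\pi_tree t) = \pi_tree (plane_prune t).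
Proof.
apply/eqmodP/asboolP => /=.
apply/reordering_series_reduction/reordering_cut/asboolP.
by have /eqmodP := reprK (\pi_tree t).
Qed.

Record offspring (R : realType) := Offspring {
  offspring_fun :> nat -> R;
  offspring_ge0 : forall k, 0 <= offspring_fun k;
  offspring_sum1 : (\sum_(0 <= k <oo) (offspring_fun k)%:E = 1)%E }.

Definition mean (R : realType) (q : offspring R) : \bar R :=
  (\sum_(0 <= k <oo) (k%:R * q k)%:E)%E.

Definition critical (R : realType) (q : offspring R) : Prop :=
  mean q = 1%E.

Definition subcritical (R : realType) (q : offspring R) : Prop :=
  (mean q < 1)%E.

(* [pgf q] and [S_of q] are meaningful on [0, 1). *)
Definition pgf (R : realType) (q : offspring R) (z : R) : R :=
  limn (series (fun m => q m * z ^+ m)).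

Definition S_of (R : realType) (q : offspring R) (z : R) : R :=
  (pgf q z - z * derive1 (pgf q) z) / (1 - derive1 (pgf q) z).

(* The product of [q k_v] over all vertices [v] of [t], its topmost vertex
   included, [k_v] being the number of offspring of [v]. *)
Fixpoint weight (R : realType) (q : nat -> R) (t : rtree) : R :=
  let: Node s := t in q (size s) * foldr (fun u w => weight q u * w) 1 s.

(* The probability that the random plane tree whose root has one offspring and
   whose other vertices independently have [k] offspring with probability [q k]
   equals [t]. *)
Definition plane_gw_mass (R : realType) (q : nat -> R) (t : rtree) : R :=
  if children t is [:: u] then weight q u else 0.

(* The law of that random tree once the order of offspring is forgotten. *)
Definition gw (R : realType) (q : offspring R) (A : set tree) : \bar R :=
  (\esum_(t in [set t : plane_tree | A (\pi_tree t)])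
     (plane_gw_mass q (val t))%:E)%E.

Section gw_measure.
Context (R : realType) (q : offspring R).

Lemma weight_ge0 t : 0 <= weight q t.
Proof.
elim/rtree_all_ind: t => s Hs /=; rewrite mulr_ge0 ?offspring_ge0//.
by elim: s Hs => //= u l IHl [u0 /IHl l0]; rewrite mulr_ge0.
Qed.

Lemma plane_gw_mass_ge0 t : 0 <= plane_gw_mass q t.
Proof. by rewrite /plane_gw_mass; case: t => [[|u [|]]]//=; exact: weight_ge0. Qed.

Let gw0 : gw q set0 = 0%E.
Proof. by rewrite /gw; exact: esum_set0. Qed.

Let gw_ge0 A : (0 <= gw q A)%E.
Proof. by apply: esum_ge0 => t _; rewrite lee_fin plane_gw_mass_ge0. Qed.

Let gw_sigma_additive : semi_sigma_additive (gw q).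
Proof.
move=> F _ tF _; apply: cvg_toP.
  by apply: is_cvg_ereal_nneg_natsum => k _; exact: gw_ge0.
rewrite /gw.
pose J k := [set t : plane_tree | F k (\pi_tree t)].
have -> : [set t : plane_tree | (\bigcup_k F k) (\pi_tree t)] = \bigcup_k J k.
  by apply/seteqP; split=> t [k _ Fk]; exists k.
rewrite esum_bigcupT; last 2 first.
- move=> i j _ _ [t [Fi Fj]]; apply: tF => //.
  by exists (\pi_tree t).
- by move=> t; rewrite lee_fin plane_gw_mass_ge0.
rewrite nneseries_esumT// => k; apply: esum_ge0 => t _.
by rewrite lee_fin plane_gw_mass_ge0.
Qed.

HB.instance Definition _ := isMeasure.Build _ tree R (gw q)
  gw0 gw_ge0 gw_sigma_additive.

End gw_measure.

Definition horton_prune_invariant (R : realType)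
    (mu : {measure set tree -> \bar R}) : Prop :=
  let nu := pushforward mu horton_prune in
  [/\ mu [set phi] = 0%E, (0 < nu [set~ phi])%E &
    forall t : tree,
      (nu ([set t] `&` [set~ phi]) / nu [set~ phi])%E = mu [set t]].

(* Generating functions determine offspring distributions, so at most one
   measure satisfies this. *)
Definition is_IGW (R : realType) (q0 : R)
    (mu : {measure set tree -> \bar R}) : Prop :=
  exists p : offspring R,
    [/\ p 1%N = 0, critical p,
        forall z, 0 <= z < 1 -> pgf p z = z + q0 * (1 - z) `^ q0^-1 &
        forall A, mu A = gw p A].

(* Main.v *)
Require Import Defs.
From mathcomp Require Import all_boot all_order all_algebra.
From mathcomp Require Import all_classical all_reals all_analysis.
From mathcomp Require Import generic_quotient ring lra.
Import Order.TTheory GRing.Theory Num.Theory.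
Import numFieldNormedType.Exports.
Local Open Scope classical_set_scope.
Local Open Scope ring_scope.
Local Open Scope quotient_scope.

Set Implicit Arguments.
Unset Strict Implicit.
Unset Printing Implicit Defensive.

(** Why the theorem holds.  Write [c := q 0].  In a non-leaf subtree every
    child of a vertex is a leaf, and thus cut, with probability [c],
    independently of the others; so the number of surviving offspring of a
    vertex is the binomial thinning [thin q c] of [q].  A vertex left with one
    child is contracted, which conditions the number of offspring on being
    different from 1, and a vertex is known not to be a leaf, which removes the
    mass [c] of childless vertices.  Hence pruning turns the law [GW(q)] into
    [GW(pruned_offspring q)], up to the probability [1 - c] that the tree
    survives ([esum_pruned]).  Evaluating both laws at the planted stars, whose
    only plane representative is the star itself, shows that invariance means
    [pruned_offspring q = q] ([prune_invariant_offspring]).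

    In terms of [D z := Q z - z], with [Q] the generating function of [q], this
    is the functional equation [D (c + (1 - c) z) = K * D z] for a constant [K]
    ([pgf_pruned], [pruned_eq]; the second needs that a power series determines
    its coefficients).  The functions [q0 * (1 - z) `^ (1 / q0)] solve it, which
    gives the invariance of [IGW(q0)].

    Conversely the functional equation has many solutions, oscillating near 1.
    Differentiating it shows that
      [(1 - S z) / (1 - z) = 1 + D z / ((1 - z) * D' z)]
    is unchanged by [z |-> c + (1 - c) z], whose iterates converge to 1.  If
    this ratio has a limit at 1 it is therefore constant, and equal to its value
    [1 - c] at 0.  The resulting equation [D = - c (1 - z) D'] integrates to
    [D z = c (1 - z) `^ (1 / c)] ([pgf_closed_form]).  Such a [Q] has mean 1,
    and [c >= 1 / 2] because all offspring numbers other than 0 are at least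
    2. *)

(** * Sums of nonnegative functions over sequences and trees *)

Lemma esumZl (R : realType) (T : choiceType) (A : set T) (r : R)
    (f : T -> \bar R) : 0 <= r -> (forall x, (0 <= f x)%E) ->
  (\esum_(x in A) (r%:E * f x) = r%:E * \esum_(x in A) f x)%E.
Proof.
move=> r0 f0; rewrite /esum -ereal_supZl//; last first.
  apply/set0P; exists (\sum_(x \in set0) f x)%E; exists set0 => //.
  exact: fsets_set0.
congr ereal_sup; apply/seteqP; split=> [_ [X XA <-]|_ [_ [X XA <-] <-]].
- by exists (\sum_(x \in X) f x)%E; [exists X|rewrite ge0_mule_fsumr].
- by exists X => //; rewrite ge0_mule_fsumr.
Qed.

Lemma esum_subset (R : realType) (T : choiceType) (A B : set T)
    (f : T -> \bar R) : B `<=` A -> (forall x, A x -> (0 <= f x)%E) ->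
    (forall x, A x -> ~ B x -> f x = 0%E) ->
  \esum_(x in A) f x = \esum_(x in B) f x.
Proof.
move=> BA f0 fB; rewrite (esumID B)// (_ : A `&` B = B); last exact/setIidr.
by rewrite [X in (_ + X)%E]esum1 ?adde0// => x [Ax nBx]; exact: fB.
Qed.

Lemma esum_fiber (R : realType) (T U : choiceType) (p : T -> option U)
    (A : set T) (f : T -> \bar R) (B : set U) : (forall x, (0 <= f x)%E) ->
  \esum_(x in [set x | A x /\ exists2 y, B y & p x = Some y]) f x =
  \esum_(y in B) \esum_(x in [set x | A x /\ p x = Some y]) f x.
Proof.
move=> f0; rewrite esum_esum//.
apply: (reindex_esum _ _ (fun yx : U * T => yx.2)); split.
- by move=> [y x] [/= By [Ax py]]; split=> //; exists y.
- move=> [y x] [y' x']; rewrite !inE /= => -[_ [_ /= px]] [_ [_ /= px']] xx'.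
  by move: px px'; rewrite xx' => -> [->].
- by move=> x [Ax [y By px]]; exists (y, x).
Qed.

Lemma esum_seq_cons (R : realType) (T : choiceType) (k : nat)
    (P : seq T -> Prop) (f : seq T -> \bar R) : (forall s, (0 <= f s)%E) ->
  \esum_(s in [set s | size s = k.+1 /\ P s]) f s =
  \esum_(x in [set: T]) \esum_(s in [set s | size s = k /\ P (x :: s)])
    f (x :: s).
Proof.
move=> f0; rewrite esum_esum//.
apply: (reindex_esum _ _ (fun xs : T * seq T => xs.1 :: xs.2)); split.
- by move=> [x s] [_ [/= <- ?]].
- by move=> [x s] [y t] _ _ /= [-> ->].
- by move=> [|x s] [//= [sk] Ps]; exists (x, s).
Qed.

Lemma esum_seq_nil (R : realType) (T : choiceType)
    (P : seq T -> Prop) (f : seq T -> \bar R) : (0 <= f [::])%E -> P [::] ->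
  \esum_(s in [set s | size s = 0%N /\ P s]) f s = f [::].
Proof.
move=> f0 P0; rewrite (_ : [set _ | _] = [set [::]]) ?esum_set1//.
by apply/seteqP; split=> [s [/size0nil ->]|_ ->].
Qed.

Lemma esum_seq_size (R : realType) (T : choiceType) (P : seq T -> Prop)
    (f : seq T -> \bar R) : (forall s, (0 <= f s)%E) ->
  \esum_(s in [set s | P s]) f s =
  (\sum_(0 <= k <oo) \esum_(s in [set s | size s = k /\ P s]) f s)%E.
Proof.
move=> f0; rewrite nneseries_esumT => [|k]; last exact: esum_ge0.
rewrite -esum_bigcupT//; last by move=> j k _ _ [s [[<- _] [<- _]]].
congr esum; apply/seteqP; split=> s; first by exists (size s).
by move=> [k _ []].
Qed.

(** By distributivity, the products over all words of length [k] add up to the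
    [k]-th power of the sum over letters. *)
Lemma esum_prod_seq (R : realType) (T : choiceType) (f : T -> R) (r : R)
    (k : nat) : (forall x, 0 <= f x) ->
  \esum_(x in [set: T]) (f x)%:E = r%:E ->
  \esum_(s in [set s | size s = k /\ True]) (\prod_(x <- s) f x)%:E
    = (r ^+ k)%:E.
Proof.
move=> f0 fr; have r0 : 0 <= r.
  by rewrite -lee_fin -fr; apply: esum_ge0 => x _; rewrite lee_fin.
have p0 s : (0 <= (\prod_(x <- s) f x)%:E)%E.
  by rewrite lee_fin; apply: prodr_ge0.
elim: k => [|k IH]; first by rewrite esum_seq_nil// big_nil.
rewrite esum_seq_cons//.
transitivity (\esum_(x in [set: T]) ((r ^+ k)%:E * (f x)%:E))%E.
  apply: eq_esum => x _; rewrite muleC -IH -esumZl//.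
  by apply: eq_esum => s _; rewrite big_cons EFinM.
by rewrite esumZl ?exprn_ge0// fr -EFinM exprSr.
Qed.

Lemma esum_rtree (R : realType) (P : rtree -> Prop) (f : rtree -> \bar R) :
  \esum_(u in [set u | P u]) f u = \esum_(s in [set s | P (Node s)]) f (Node s).
Proof.
apply: reindex_esum; split=> [s //|s t _ _ []//|[s] Ps].
by exists s.
Qed.

(** * Convergent real series *)

Section sums.
Context {R : realType}.
Implicit Types (u v : nat -> R) (a b c : R).

(** An inductive wrapper, so that the elaborator does not unfold the filter
    inclusion and add its quantified neighbourhood to lemmas about sums. *)
Variant sums_to u a : Prop := SumsTo of series u @ \oo --> a.

Lemma sums_to_lim u a : sums_to u a -> limn (series u) = a.
Proof. by case=> /cvg_lim ->. Qed.

Lemma sums_to_eq u v a : u =1 v -> sums_to u a -> sums_to v a.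
Proof. by move=> /funext ->. Qed.

Lemma sums_to_unique u a b : sums_to u a -> sums_to u b -> a = b.
Proof. by move=> /sums_to_lim <- /sums_to_lim <-. Qed.

Lemma sums_toD u v a b : sums_to u a -> sums_to v b ->
  sums_to (fun k => u k + v k) (a + b).
Proof.
move=> [ua] [vb]; split; rewrite (_ : series _ = series u + series v).
  exact: cvgD.
by apply/funext => n; rewrite /series /= big_split.
Qed.

Lemma sums_toZ c u a : sums_to u a -> sums_to (fun k => c * u k) (c * a).
Proof.
move=> [ua]; split; rewrite (_ : series _ = (fun n => c * series u n)).
  by apply: cvgM => //; exact: cvg_cst.
by apply/funext => n; rewrite /series /= -mulr_sumr.
Qed.

#[local] Arguments sums_toZ c {u a}.

Lemma sums_toB u v a b : sums_to u a -> sums_to v b ->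
  sums_to (fun k => u k - v k) (a - b).
Proof.
move=> ua vb; have := sums_toD ua (sums_toZ (-1) vb); rewrite mulN1r.
by apply: sums_to_eq => k; rewrite mulN1r.
Qed.

Lemma sums_to_delta m c : sums_to (fun k => (k == m)%:R * c) c.
Proof.
split; apply: cvg_near_cst; exists m.+1 => // n /= mn.
rewrite /series /= (bigD1_seq m) ?mem_index_iota ?iota_uniq//= eqxx mul1r.
by rewrite big1 ?addr0// => i /negbTE ->; rewrite mul0r.
Qed.

#[local] Arguments sums_to_delta : clear implicits.

Lemma sums_to_le u v a b : (forall k, u k <= v k) ->
  sums_to u a -> sums_to v b -> a <= b.
Proof.
move=> uv [ua] [vb]; apply: (ler_cvg_to ua vb); apply: nearW => n.
by apply: ler_sum => i _.
Qed.

Lemma sums_to_ge0 u a : (forall k, 0 <= u k) -> sums_to u a -> 0 <= a.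
Proof.
move=> u0; apply: (@sums_to_le (fun=> 0 * 0)); first by move=> k; rewrite mul0r.
have := sums_toZ 0 (sums_to_delta 0 0); rewrite mul0r; apply: sums_to_eq => k.
by rewrite !mul0r.
Qed.

Lemma sums_to_term u a m : (forall k, 0 <= u k) -> sums_to u a -> u m <= a.
Proof.
move=> u0; apply: sums_to_le (sums_to_delta m (u m)) => k.
by case: eqP => [->|_]; rewrite ?mul1r// mul0r.
Qed.

(** Bridge between tree sums, which live in the extended reals, and generating
    functions, where differences are needed. *)
Lemma nneseries_sums_to u a : (forall k, 0 <= u k) ->
  (\sum_(0 <= k <oo) (u k)%:E = a%:E)%E <-> sums_to u a.
Proof.
move=> u0; have E : (fun n => \sum_(0 <= k < n) (u k)%:E)%E = EFin \o series u.
  by apply/funext => n; rewrite /series /= sumEFin.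
have uc : cvgn (fun n => \sum_(0 <= k < n) (u k)%:E)%E.
  by apply: is_cvg_nneseries => k _ _; rewrite lee_fin.
split=> [ua|[ua]].
  by split; move: uc; rewrite ua E => /fine_cvgP[].
by rewrite E; apply: cvg_lim => //; apply: cvg_EFin; [exact: nearW|].
Qed.

Lemma sums_to_dominated u v b : (forall k, 0 <= u k <= v k) ->
  sums_to v b -> exists a, sums_to u a.
Proof.
move=> uv [vb]; exists (limn (series u)).
have uc : cvgn (series u).
  apply: (@series_le_cvg _ u v); last by apply/cvg_ex; exists b.
  - by move=> k; have /andP[] := uv k.
  - by move=> k; have /andP[] := uv k; exact: le_trans.
  - by move=> k; have /andP[] := uv k.
by split; exact: uc.
Qed.

End sums.

Arguments sums_toZ {R} c {u a}.
Arguments sums_to_delta {R} m c.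

(** * Offspring distributions *)

Section offspring_facts.
Context {R : realType} (q : offspring R).

Lemma offspring_sums : sums_to q 1.
Proof.
apply/nneseries_sums_to; [exact: offspring_ge0|exact: offspring_sum1].
Qed.

Lemma offspring_le1 k : q k <= 1.
Proof. by apply: sums_to_term offspring_sums; exact: offspring_ge0. Qed.

Lemma pgf_sums z : 0 <= z <= 1 -> sums_to (fun k => q k * z ^+ k) (pgf q z).
Proof.
move=> /andP[z0 z1]; have [|a qa] := sums_to_dominated _ offspring_sums
    (u := fun k => q k * z ^+ k).
  move=> k; rewrite mulr_ge0 ?exprn_ge0 ?offspring_ge0//=.
  by rewrite ler_piMr ?offspring_ge0// exprn_ile1.
by rewrite /pgf (sums_to_lim qa).
Qed.

Lemma pgf0 : pgf q 0 = q 0%N.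
Proof.
have z01 : 0 <= (0 : R) <= 1 by rewrite lexx ler01.
apply: sums_to_unique (pgf_sums z01) _.
apply: sums_to_eq (sums_to_delta 0 (q 0%N)) => -[|k].
  by rewrite mul1r expr0 mulr1.
by rewrite exprS !(mul0r, mulr0).
Qed.

Lemma mean_sums : critical q \/ subcritical q ->
  exists2 m : R, sums_to (fun k => k%:R * q k) m & m <= 1.
Proof.
have m0 k : 0 <= k%:R * q k by rewrite mulr_ge0// offspring_ge0.
have mge0 : (0 <= mean q)%E by apply: nneseries_ge0 => k _ _; rewrite lee_fin.
move=> qc; have m1 : (mean q <= 1)%E by case: qc => [->|/ltW].
have mE : mean q = (fine (mean q))%:E.
  by rewrite fineK// ge0_fin_numE// (le_lt_trans m1)// ltry.
exists (fine (mean q)); last by rewrite -lee_fin -mE.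
exact/nneseries_sums_to.
Qed.

Hypothesis q1_eq0 : q 1%N = 0.
Hypothesis q_crit : critical q \/ subcritical q.

(** All other offspring numbers are at least 2, so twice their total mass is at
    most the mean. *)
Lemma offspring_half : 1 / 2 <= q 0%N.
Proof.
have [m qm m1] := mean_sums q_crit.
have := sums_toB offspring_sums (sums_to_delta 0%N (q 0%N)).
move=> /(sums_toZ 2) h; suff : 2 * (1 - q 0%N) <= m by lra.
apply: (sums_to_le _ h qm) => k; have := offspring_ge0 q k.
case: k => [|[|k]] q0;
  rewrite ?eqxx ?mul1r ?mul0r ?subr0 ?q1_eq0 ?subrr ?mulr0//=.
by rewrite ler_wpM2r// ler_nat.
Qed.

(** Quantitative form of the absence of a fixed point of the generating function
    below 1: it sums [z ^ k >= 1 - k (1 - z) + (1 - z) ^ 2], true for [k >= 2],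
    and corrects the term [k = 0]. *)
Lemma pgf_lower z : 0 <= z <= 1 ->
  z + (1 - z) ^+ 2 * (1 - q 0%N) <= pgf q z.
Proof.
move=> z01; have [m qm m1] := mean_sums q_crit.
have := sums_toD (sums_toD (pgf_sums z01) (sums_toZ (1 - z) qm))
  (sums_to_delta 0%N (q 0%N * (1 - z) ^+ 2)).
have := sums_toZ (1 + (1 - z) ^+ 2) offspring_sums.
move=> /sums_to_le h /h{h}; case/andP: z01 => z0 z1 h.
have {}h : (1 + (1 - z) ^+ 2) * 1 <=
   pgf q z + (1 - z) * m + q 0%N * (1 - z) ^+ 2.
  apply: h => -[|[|k]].
  - by rewrite expr0 eqxx mul1r; lra.
  - by rewrite q1_eq0 !(mulr0, mul0r)//= !addr0.
  rewrite mul0r addr0.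
  suff h : 1 + (1 - z) ^+ 2 <= z ^+ k.+2 + (1 - z) * k.+2%:R.
    by have := ler_wpM2r (offspring_ge0 q k.+2) h; lra.
  elim: k => [|k IH]; first by rewrite !expr2; nra.
  rewrite [z ^+ _]exprS -[k.+3%:R]natr1.
  have zk : z ^+ k.+2 <= 1 by rewrite exprn_ile1.
  have : 0 <= (1 - z) * (1 - z ^+ k.+2) by rewrite mulr_ge0 ?subr_ge0.
  by lra.
have : (1 - z) * m <= 1 - z by rewrite ler_piMr// subr_ge0.
by lra.
Qed.

End offspring_facts.

Arguments offspring_sums {R} q.
Arguments pgf_sums {R} q {z}.
Arguments pgf0 {R} q.

(** * The tree is finite almost surely *)

Section weights.
Context {R : realType} (q : offspring R).

Lemma weight_Node (r : nat -> R) s :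
  weight r (Node s) = r (size s) * \prod_(u <- s) weight r u.
Proof. by rewrite /= unlock. Qed.

(** Splitting a tree at its topmost vertex: the generating function maps the
    total mass of the subtrees to the total mass of the trees. *)
Lemma esum_branching (f : rtree -> R) r : (forall u, 0 <= f u) -> r <= 1 ->
  \esum_(u in [set: rtree]) (f u)%:E = r%:E ->
  \esum_(s in [set: seq rtree]) (q (size s) * \prod_(u <- s) f u)%:E =
  (pgf q r)%:E.
Proof.
move=> f0 r1 fr; have r0 : 0 <= r.
  by rewrite -lee_fin -fr; apply: esum_ge0 => x _; rewrite lee_fin.
have p0 s : (0 <= (\prod_(u <- s) f u)%:E)%E by rewrite lee_fin prodr_ge0.
rewrite [LHS](esum_seq_size (fun=> True)); last first.
  by move=> s; rewrite lee_fin mulr_ge0 ?offspring_ge0// prodr_ge0.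
transitivity (\sum_(0 <= k <oo) (q k * r ^+ k)%:E)%E.
  apply: eq_eseriesr => k _.
  rewrite EFinM -(esum_prod_seq k f0 fr) -esumZl ?offspring_ge0//.
  by apply: eq_esum => s [<- _]; rewrite EFinM.
apply/nneseries_sums_to; last by apply: pgf_sums; rewrite r0.
by move=> k; rewrite mulr_ge0 ?offspring_ge0// exprn_ge0.
Qed.

(** Trees of height at least [n] get weight 0.  The total mass of all trees is
    first bounded through these truncations, since it might a priori be an
    infinite fixed point of the branching recursion. *)
Fixpoint truncated_weight (n : nat) (t : rtree) : R :=
  if n is n'.+1 then
    let: Node s := t in q (size s) * \prod_(u <- s) truncated_weight n' u
  else 0.

Lemma truncated_weight_ge0 n t : 0 <= truncated_weight n t.
Proof.
elim: n t => //= n IH [s]; rewrite mulr_ge0 ?offspring_ge0//.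
by rewrite prodr_ge0.
Qed.

Lemma truncated_weightE t :
  exists n0, forall n, (n0 <= n)%N -> truncated_weight n t = weight q t.
Proof.
elim/rtree_all_ind: t => s Hs.
suff [n0 Hn] : exists n0, forall n, (n0 <= n)%N ->
    \prod_(u <- s) truncated_weight n u = \prod_(u <- s) weight q u.
  by exists n0.+1 => -[//|n] /Hn E; rewrite weight_Node -E.
elim: s Hs => [|u s IH] /=; first by exists 0%N => n _; rewrite !big_nil.
move=> [[n1 H1] /IH[n2 H2]]; exists (maxn n1 n2) => n.
by rewrite geq_max => /andP[/H1 E1 /H2 E2]; rewrite !big_cons E1 E2.
Qed.

Lemma esum_truncated_weight n : exists2 r : R, 0 <= r <= 1 &
  \esum_(u in [set: rtree]) (truncated_weight n u)%:E = r%:E.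
Proof.
elim: n => [|n [r /andP[r0 r1] IH]].
  by exists 0; rewrite ?lexx ?ler01//= esum1.
have r01 : 0 <= r <= 1 by rewrite r0.
exists (pgf q r).
  have := sums_to_ge0 _ (pgf_sums q r01) => -> /=; last first.
    by move=> k; rewrite mulr_ge0 ?offspring_ge0// exprn_ge0.
  apply: sums_to_le (pgf_sums q r01) (offspring_sums q) => k.
  by rewrite ler_piMr ?offspring_ge0// exprn_ile1.
rewrite [LHS](esum_rtree (fun=> True)).
by apply: esum_branching => // u; exact: truncated_weight_ge0.
Qed.

Lemma esum_weight_le1 : (\esum_(u in [set: rtree]) (weight q u)%:E <= 1)%E.
Proof.
apply: ge_ereal_sup => _ [X [finX _] <-].
have [n Hn] : exists n0, forall n, (n0 <= n)%N ->
    forall u, X u -> truncated_weight n u = weight q u.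
  have /finite_seqP[l ->] := finX; elim: l {finX} => [|v l [n1 H1]].
    by exists 0%N.
  have [n2 H2] := truncated_weightE v; exists (maxn n1 n2) => n.
  rewrite geq_max => /andP[/H1 {}H1 /H2 {}H2] u /=.
  by rewrite inE => /orP[/eqP ->|/H1].
have [r /andP[_ r1] rE] := esum_truncated_weight n.
rewrite (le_trans _ (_ : r%:E <= 1)%E) ?lee_fin// -rE.
apply: esum_ge; exists X => //.
by apply: lee_fsum => // u Xu; rewrite (Hn n).
Qed.

(** The total mass is a fixed point of the generating function between [q 0]
    and 1, and [pgf_lower] leaves only the fixed point 1. *)
Lemma esum_weight : q 1%N = 0 -> critical q \/ subcritical q ->
  \esum_(u in [set: rtree]) (weight q u)%:E = 1%E.
Proof.
move=> q1 qc.
set M := (X in X = _); have M1 : (M <= 1)%E := esum_weight_le1.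
have M0 : (0 <= M)%E by apply: esum_ge0 => u _; rewrite lee_fin weight_ge0.
have ME : M = (fine M)%:E.
  by rewrite fineK// ge0_fin_numE// (le_lt_trans M1)// ltry.
move: M0 M1; rewrite ME !lee_fin; set r := fine M in ME * => r0 r1.
have rQ : pgf q r = r.
  apply/EFin_inj; rewrite -(@esum_branching (weight q)) -?ME//; last first.
    by move=> u; exact: weight_ge0.
  rewrite /M [RHS](esum_rtree (fun=> True)).
  by apply: eq_esum => s _; rewrite weight_Node.
have r01 : 0 <= r <= 1 by rewrite r0.
have q0r : q 0%N <= r.
  have := @sums_to_term _ _ _ 0%N _ (pgf_sums q r01); rewrite mulr1 rQ; apply.
  by move=> k; rewrite mulr_ge0 ?offspring_ge0// exprn_ge0.
have := pgf_lower q1 qc r01; rewrite rQ => h.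
congr EFin; apply/eqP; rewrite eq_le r1 /= leNgt; apply/negP => rlt1.
have : 0 < (1 - r) ^+ 2 * (1 - q 0%N).
  by rewrite mulr_gt0 ?exprn_gt0 ?subr_gt0// (le_lt_trans q0r).
by lra.
Qed.

End weights.

(** * Binomial thinning *)

Section thinning.
Context {R : realType} (q : offspring R) (c : R).
Hypothesis c01 : 0 <= c <= 1.

(** The probability that [m] of [k] items survive when each one is deleted with
    probability [c]. *)
Definition binom_mass (k m : nat) : R :=
  'C(k, m)%:R * c ^+ (k - m) * (1 - c) ^+ m.

Definition thin (m : nat) : R := limn (series (fun k => q k * binom_mass k m)).

Lemma binom_mass_ge0 k m : 0 <= binom_mass k m.
Proof.
case/andP: c01 => c0 c1.
by rewrite !mulr_ge0 ?exprn_ge0 ?subr_ge0.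
Qed.

Lemma binom_mass_sums z k :
  sums_to (fun m => binom_mass k m * z ^+ m) ((c + (1 - c) * z) ^+ k).
Proof.
split; apply: cvg_near_cst; exists k.+1 => // n /= kn.
rewrite /series /= (big_cat_nat (n := k.+1))//= [X in _ + X]big_nat_cond.
rewrite [X in _ + X]big1 ?addr0 => [|m /andP[/andP[km _] _]]; last first.
  by rewrite /binom_mass bin_small// !mul0r.
rewrite exprDn big_mkord; apply: eq_bigr => m _.
by rewrite /binom_mass [(_ * z) ^+ _]exprMn -[RHS]mulr_natl !mulrA.
Qed.

Lemma binom_mass_le1 k m : binom_mass k m <= 1.
Proof.
have := binom_mass_sums 1 k; rewrite mulr1 addrC subrK expr1n => h.
have := @sums_to_term _ _ _ m _ h; rewrite expr1n mulr1; apply => j.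
by rewrite expr1n mulr1 binom_mass_ge0.
Qed.

Lemma thin_sums m : sums_to (fun k => q k * binom_mass k m) (thin m).
Proof.
have [|a qa] := sums_to_dominated _ (offspring_sums q)
    (u := fun k => q k * binom_mass k m).
  move=> k; rewrite mulr_ge0 ?offspring_ge0 ?binom_mass_ge0//=.
  by rewrite ler_piMr ?offspring_ge0// binom_mass_le1.
by rewrite /thin (sums_to_lim qa).
Qed.

#[local] Arguments thin_sums : clear implicits.

Lemma thin_ge0 m : 0 <= thin m.
Proof.
apply: (sums_to_ge0 _ (thin_sums m)) => k.
by rewrite mulr_ge0 ?offspring_ge0 ?binom_mass_ge0.
Qed.

Lemma thin_le1 m : thin m <= 1.
Proof.
apply: sums_to_le (thin_sums m) (offspring_sums q) => k.
by rewrite ler_piMr ?offspring_ge0// binom_mass_le1.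
Qed.

(** Interchanging the two nonnegative sums and using the binomial formula. *)
Lemma thin_pgf z : 0 <= z <= 1 ->
  sums_to (fun m => thin m * z ^+ m) (pgf q (c + (1 - c) * z)).
Proof.
move=> /andP[z0 z1]; case/andP: (c01) => c0 c1.
have x01 : 0 <= c + (1 - c) * z <= 1.
  apply/andP; split; first by rewrite addr_ge0// mulr_ge0// subr_ge0.
  by have : (1 - c) * z <= 1 - c; [rewrite ler_piMr// subr_ge0|lra].
have zm m : 0 <= z ^+ m by rewrite exprn_ge0.
have t0 k m : 0 <= q k * (binom_mass k m * z ^+ m).
  exact: mulr_ge0 (offspring_ge0 q k) (mulr_ge0 (binom_mass_ge0 k m) (zm m)).
apply/nneseries_sums_to; first by move=> m; rewrite mulr_ge0 ?thin_ge0.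
transitivity (\sum_(0 <= m <oo) \sum_(0 <= k <oo)
    (q k * (binom_mass k m * z ^+ m))%:E)%E.
  apply: eq_eseriesr => m _; apply/esym/nneseries_sums_to.
    by move=> k; exact: t0.
  rewrite mulrC; apply: sums_to_eq (sums_toZ (z ^+ m) (thin_sums m)) => k.
  by rewrite mulrCA [_ * binom_mass _ _]mulrC.
rewrite nneseries_interchange; last first.
  by move=> k m; rewrite lee_fin.
transitivity (\sum_(0 <= k <oo) (q k * (c + (1 - c) * z) ^+ k)%:E)%E.
  apply: eq_eseriesr => k _; apply/nneseries_sums_to.
    by move=> m; exact: t0.
  by apply: sums_toZ; exact: binom_mass_sums.
apply/nneseries_sums_to; last exact: pgf_sums.
by move=> k; rewrite mulr_ge0 ?offspring_ge0// exprn_ge0//; case/andP: x01.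
Qed.

End thinning.

(** * The law of the pruned plane tree *)

(** [None] stands for a subtree that is cut together with its parental edge. *)
Definition pruned_subtree (u : rtree) : option rtree :=
  if is_leaf u then None else Some (Defs.contract (cut_leaves u)).

Lemma pruned_subtree_Node s : s != [::] ->
  pruned_subtree (Node s) =
  Some (if pmap pruned_subtree s is [:: v] then v
        else Node (pmap pruned_subtree s)).
Proof.
move=> s0; rewrite /pruned_subtree /is_leaf /= /nilp size_eq0 (negbTE s0).
congr Some; rewrite [in LHS](_ : [seq Defs.contract u | u <- _] =
  pmap pruned_subtree s)//.
elim: s {s0} => //= u s IH; rewrite /pruned_subtree.
by case: (is_leaf u) => //=; rewrite IH.
Qed.

Lemma prune_planted u :
  prune (Node [:: u]) = Node (seq_of_opt (pruned_subtree u)).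
Proof. by rewrite /prune /pruned_subtree /=; case: (is_leaf u). Qed.

Section prune_law.
Context {R : realType} (q : offspring R).
Hypothesis q1_eq0 : q 1%N = 0.
Hypothesis q_crit : critical q \/ subcritical q.
Hypothesis q0_lt1 : q 0%N < 1.

Let c : R := q 0%N.

Let c01 : 0 <= c <= 1.
Proof. by rewrite offspring_ge0 offspring_le1. Qed.

(** The left-hand side is [(1 - c) Q'(c)], and [Q'(c) <= c * mean] since there
    is no offspring number 1. *)
Lemma thin1_le : thin q (q 0%N) 1 <= (1 - q 0%N) * q 0%N.
Proof.
have [m qm m1] := mean_sums q_crit; have /andP[c0 c1] := c01.
have cc0 : 0 <= (1 - c) * c by rewrite mulr_ge0 ?subr_ge0.
rewrite -[leRHS]mulr1; apply: le_trans (ler_wpM2l cc0 m1).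
apply: sums_to_le (thin_sums q c01 1) (sums_toZ _ qm) => k.
rewrite /binom_mass bin1 expr1.
case: k => [|[|k]]; rewrite ?q1_eq0 ?(mul0r, mulr0)// subn1 /= exprS.
have ck : c ^+ k <= 1 by rewrite exprn_ile1.
rewrite [leLHS](_ : _ = c ^+ k * ((1 - c) * c * (k.+2%:R * q k.+2))).
  by rewrite ler_piMl// mulr_ge0// mulr_ge0// offspring_ge0.
by ring.
Qed.

Lemma thin1_lt : 0 < 1 - q 0%N - thin q (q 0%N) 1.
Proof.
have := thin1_le; have : 0 < (1 - q 0%N) * (1 - q 0%N).
  by rewrite mulr_gt0 ?subr_gt0.
by lra.
Qed.

(** The thinned law, conditioned on the vertex having been no leaf of the
    original tree (hence the correction at 0) and on not being contracted. *)
Definition pruned_offspring (m : nat) : R :=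
  if m == 1%N then 0
  else (thin q (q 0%N) m - (m == 0%N)%:R * q 0%N) /
       (1 - q 0%N - thin q (q 0%N) 1).

(** The law of the pruned subtree given that it is not cut; its recursion shows
    below that it is the Galton-Watson weight of [pruned_offspring]. *)
Let pruned_law (v : rtree) : R :=
  fine (\esum_(u in [set u | pruned_subtree u = Some v])
    (weight q u)%:E) / (1 - c).

Let c_neq1 : 1 - c != 0.
Proof. by rewrite subr_eq0 eq_sym lt_eqF. Qed.

Let pruned_law_ge0 v : 0 <= pruned_law v.
Proof.
apply: divr_ge0; last by rewrite subr_ge0 ltW.
apply/fine_ge0/esum_ge0 => u _.
by rewrite lee_fin weight_ge0.
Qed.

Let pruned_massE v :
  \esum_(u in [set u | pruned_subtree u = Some v]) (weight q u)%:E
    = ((1 - c) * pruned_law v)%:E.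
Proof.
rewrite mulrC divfK// fineK//.
set A := (X in esum X _).
have := esum_weight_le1 q; rewrite (esumID A); last first.
  by move=> u _; rewrite lee_fin weight_ge0.
rewrite setTI => le1; have e0 B : (0 <= \esum_(u in B) (weight q u)%:E)%E.
  by apply: esum_ge0 => u _; rewrite lee_fin weight_ge0.
rewrite ge0_fin_numE//; apply: le_lt_trans (ltry 1).
by apply: le_trans le1; rewrite leeDl.
Qed.

Let binom_massS k m : binom_mass c k.+1 m.+1 =
  c * binom_mass c k m.+1 + (1 - c) * binom_mass c k m.
Proof.
rewrite /binom_mass binS natrD subSS exprS.
have [km|mk] := leqP k m; first by rewrite bin_small//; ring.
by rewrite (_ : k - m = (k - m.+1).+1)%N ?exprS ?subnSK//; ring.
Qed.

(** A forest of [k] independent subtrees leaves the forest [vs] of surviving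
    pruned subtrees: by induction on [k], according to whether the first subtree
    is a leaf, with Pascal's rule adding the two cases. *)
Let esum_pmap k vs :
  \esum_(s in [set s | size s = k /\ pmap pruned_subtree s = vs])
    (\prod_(u <- s) weight q u)%:E =
  (binom_mass c k (size vs) * \prod_(v <- vs) pruned_law v)%:E.
Proof.
have p0 s : (0 <= (\prod_(u <- s) weight q u)%:E)%E.
  by rewrite lee_fin prodr_ge0// => u _; exact: weight_ge0.
elim: k vs => [|k IH] vs.
  case: vs => [|v vs].
    by rewrite esum_seq_nil//= !big_nil /binom_mass bin0 !expr0 !mulr1.
  rewrite esum1 ?/binom_mass ?bin0n ?mul0r//= => s [/size0nil ->] //.
rewrite esum_seq_cons//.
rewrite (esumID [set Node [::]]); last by move=> u _; exact: esum_ge0.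
rewrite setTI esum_set1; last exact: esum_ge0.
rewrite [X in (X + _)%E](_ : _ =
    (c * (binom_mass c k (size vs) * \prod_(v <- vs) pruned_law v))%:E);
    last first.
  rewrite [RHS]EFinM -IH -esumZl//; last by have /andP[] := c01.
  by apply: eq_esum => s _; rewrite big_cons weight_Node big_nil mulr1 EFinM.
case: vs => [|v vs].
  rewrite [X in (_ + X)%E]esum1 ?adde0.
    by rewrite /binom_mass !bin0 !subn0 exprS !expr0; congr EFin; ring.
  move=> u [_ /= u0]; rewrite esum1// => s [_].
  rewrite /pruned_subtree; case: ifP => //.
  by case: u u0 => -[].
rewrite (esum_subset (B := [set u | pruned_subtree u = Some v])).
- rewrite (eq_esum (b := fun u => ((binom_mass c k (size vs) *
      \prod_(v <- vs) pruned_law v)%:E * (weight q u)%:E)%E)).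
    rewrite esumZl ?pruned_massE; last 2 first.
    + by rewrite mulr_ge0 ?binom_mass_ge0// prodr_ge0.
    + by move=> u; rewrite lee_fin weight_ge0.
    rewrite -!EFinM -EFinD big_cons /= binom_massS; congr EFin; ring.
  move=> u pu; rewrite -IH muleC -esumZl ?weight_ge0//.
  rewrite /= (pu : pruned_subtree u = Some v) /=.
  rewrite (_ : [set s | _ /\ _ :: _ = _] =
      [set s | size s = k /\ pmap pruned_subtree s = vs]); last first.
    by apply/seteqP; split=> s /= [sk]; [case|] => ->.
  by apply: eq_esum => s _; rewrite big_cons EFinM.
- move=> u /= pu; split=> // u0.
  by move: pu; rewrite u0.
- by move=> u _; exact: esum_ge0.
- move=> u [_ /= u0] nu; rewrite esum1// => s [_].
  case E: (pruned_subtree u) => [w|] /=.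
    by case=> wv _; case: nu; rewrite /= E wv.
  move: E; rewrite /pruned_subtree; case: ifP => //.
  by case: u {nu} u0 => -[].
Qed.

Let esum_pmap_nonleaf vs :
  \esum_(s in [set s | s != [::] /\ pmap pruned_subtree s = vs])
    (weight q (Node s))%:E =
  ((thin q c (size vs) - (size vs == 0%N)%:R * c) *
    \prod_(v <- vs) pruned_law v)%:E.
Proof.
have P0 : 0 <= \prod_(v <- vs) pruned_law v by rewrite prodr_ge0.
rewrite esum_seq_size => [|s]; last by rewrite lee_fin weight_ge0.
transitivity (\sum_(0 <= k <oo) ((k != 0%N)%:R *
    (q k * (binom_mass c k (size vs) * \prod_(v <- vs) pruned_law v)))%:E)%E.
  apply: eq_eseriesr => -[|k] _.
    by rewrite mul0r esum1// => s [/size0nil ->] [].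
  rewrite mul1r EFinM -esum_pmap -esumZl ?offspring_ge0//; last first.
    by move=> s; rewrite lee_fin prodr_ge0// => u _; exact: weight_ge0.
  rewrite (_ : [set s | _ /\ _] =
      [set s | size s = k.+1 /\ pmap pruned_subtree s = vs]); last first.
    by apply/seteqP; split=> s /= [sk]; [case|move=> <-]; case: s sk.
  by apply: eq_esum => s [sk _]; rewrite weight_Node sk EFinM.
apply/nneseries_sums_to.
  move=> k; rewrite mulr_ge0// mulr_ge0 ?offspring_ge0//.
  by rewrite mulr_ge0 ?binom_mass_ge0.
have := sums_toB (thin_sums q c01 (size vs))
  (sums_to_delta 0%N ((size vs == 0%N)%:R * c)).
move=> /(sums_toZ (\prod_(v <- vs) pruned_law v));
rewrite [X in _ -> sums_to _ X]mulrC.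
apply: sums_to_eq => -[|k]; last by rewrite /=; ring.
rewrite /binom_mass bin0n sub0n /= expr0; case: eqP => [->|_] /=.
  by rewrite -/c expr0; ring.
by ring.
Qed.

(** A subtree pruned to [Node vs] either has a topmost vertex whose surviving
    children are pruned to [vs], or one with a single surviving child, itself
    pruned to [Node vs], in place of which that child is promoted.  The second
    case contributes the unknown again, with the factor [thin 1 < 1 - c]. *)
Let pruned_law_recursion vs : size vs != 1%N ->
  (1 - c - thin q c 1) * pruned_law (Node vs) =
  (thin q c (size vs) - (size vs == 0%N)%:R * c) * \prod_(v <- vs) pruned_law v.
Proof.
move=> vs1; suff E : ((1 - c) * pruned_law (Node vs))%:E =
   (((thin q c (size vs) - (size vs == 0%N)%:R * c) *
      \prod_(v <- vs) pruned_law v)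
    + thin q c 1 * pruned_law (Node vs))%:E
  by have := EFin_inj E; lra.
have := esum_pmap_nonleaf [:: Node vs].
rewrite big_cons big_nil mulr1 /= mul0r subr0 EFinD => <-.
rewrite -esum_pmap_nonleaf -pruned_massE esum_rtree.
rewrite (esumID [set s | pmap pruned_subtree s = vs]); last first.
  by move=> s _; rewrite lee_fin weight_ge0.
have key s : s != [::] -> pruned_subtree (Node s) = Some (Node vs) <->
    pmap pruned_subtree s = vs \/ pmap pruned_subtree s = [:: Node vs].
  move=> s0; rewrite pruned_subtree_Node//; split.
    by move: (pmap _ _) => -[|w [|w' l]] [->]; by [left|right].
  by case=> ->//; case: vs vs1 => [|v [|]].
have nN s : pruned_subtree (Node s) = Some (Node vs) -> s != [::].
  by case: s.
congr (_ + _)%E; apply: (congr1 (fun A => esum A _)); apply/seteqP;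
  split=> s /=.
- by move=> [/nN s0 sv].
- by move=> [s0 sv]; split=> //; apply/key => //; left.
- by move=> [/[dup] /nN s0 /(key _ s0)[|]].
- move=> [s0 sv]; split; first by apply/key => //; right.
  by rewrite sv => vv; move: vs1; rewrite -vv.
Qed.

Lemma esum_pruned v :
  \esum_(u in [set u | pruned_subtree u = Some v]) (weight q u)%:E
    = ((1 - q 0%N) * weight pruned_offspring v)%:E.
Proof.
rewrite pruned_massE; congr (_ * _)%:E.
elim/rtree_all_ind: v => s Hs; rewrite weight_Node.
rewrite (_ : \prod_(u <- s) weight pruned_offspring u =
    \prod_(u <- s) pruned_law u).
  rewrite /pruned_offspring; case: ifPn => [s1|/pruned_law_recursion h].
    rewrite mul0r /pruned_law esum1 ?mul0r// => u /=.
    rewrite /pruned_subtree; case: ifP => // _ [cu].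
    by have := no_unary_contract (cut_leaves u); rewrite cu /= s1.
  apply: (mulfI (lt0r_neq0 thin1_lt)); rewrite h /c; field.
  exact: lt0r_neq0 thin1_lt.
elim: s Hs => [|v s IH] /=; first by rewrite !big_nil.
by case=> E1 /IH E2; rewrite !big_cons E1 E2.
Qed.

Lemma weight_pruned_ge0 v : 0 <= weight pruned_offspring v.
Proof.
rewrite -(pmulr_rge0 _ (_ : 0 < 1 - q 0%N)) ?subr_gt0// -lee_fin.
rewrite -esum_pruned; apply: esum_ge0 => w _.
by rewrite lee_fin weight_ge0.
Qed.

End prune_law.

(** * Pruning the law on unlabeled trees *)

Lemma tree_eqP (t u : plane_tree) :
  \pi_tree t = \pi_tree u <-> reordering (val t) (val u).
Proof. by split=> [/eqmodP/asboolP|h] //; apply/eqmodP/asboolP. Qed.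

Lemma plane_tree_case (t : plane_tree) :
  val t = Node [::] \/ exists2 u, no_unary u & val t = Node [:: u].
Proof.
case: t => -[[|u [|]]]//= h; [by left|right; exists u => //].
by move: h; rewrite /planted /reduced /= andbT.
Qed.

Definition stem (u : rtree) (nu : no_unary u) : plane_tree.
Proof. by exists (Node [:: u]); rewrite /planted /reduced /= nu. Defined.

Lemma horton_prune_stem_phi u (nu : no_unary u) :
  horton_prune (\pi_tree (stem nu)) = phi <-> u = Node [::].
Proof.
rewrite horton_prune_pi /phi tree_eqP /= prune_planted /pruned_subtree.
split=> [|->]; last exact: reordering_refl.
by case: ifP => [|_ /reordering_size//]; case: u {nu} => -[].
Qed.

Section gw_sums.
Context {R : realType} (q : offspring R).

(** Sums over planted plane trees become sums over the subtree above the root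
    edge; the tree reduced to its root has weight 0. *)
Lemma gw_stems (A : set tree) : gw q A =
  \esum_(u in [set u | exists nu : no_unary u, A (\pi_tree (stem nu))])
    (weight q u)%:E.
Proof.
pose top (t : plane_tree) := head (Node [::]) (children (val t)).
pose B := [set t : plane_tree | A (\pi_tree t) /\ children (val t) <> [::]].
rewrite /gw (@esum_subset _ _ _ B); last 3 first.
- by move=> t [].
- by move=> t _; rewrite lee_fin plane_gw_mass_ge0.
- move=> t At Bt; rewrite /plane_gw_mass; case E: (children _) => [//|u s].
  by case: Bt; split; rewrite ?E.
rewrite [RHS](reindex_esum B _ top).
  apply: eq_esum => t [_]; rewrite /plane_gw_mass /top.
  by case: (plane_tree_case t) => [|[u nu]] ->.
split.
- move=> t [At]; rewrite /top; have [->//|[u nu tE] _] := plane_tree_case t.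
  rewrite tE /=; exists nu; rewrite (_ : stem nu = t)//.
  exact: val_inj.
- move=> t t'; rewrite !inE => -[_ t0] [_ t'0]; rewrite /top => tt'.
  apply: val_inj; move: t0 t'0 tt'.
  have [->//|[u nu ->]] := plane_tree_case t.
  by have [->//|[u' nu' ->]] := plane_tree_case t' => _ _ /= ->.
- by move=> u [nu Au]; exists (stem nu).
Qed.

Hypothesis q1_eq0 : q 1%N = 0.

(** Since [q 1 = 0], trees that are not reduced may be added freely to the index
    set of a sum of weights. *)
Lemma weight_unary u : ~~ no_unary u -> weight q u = 0.
Proof.
elim/rtree_all_ind: u => s Hs; rewrite weight_Node /= negb_and negbK.
case/orP => [/eqP ->|]; first by rewrite q1_eq0 mul0r.
move=> h; suff -> : \prod_(u <- s) weight q u = 0 by rewrite mulr0.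
elim: s Hs h => //= u s IH [Hu /IH{}IH]; rewrite negb_and big_cons.
by case/orP => [/Hu ->|/IH ->]; rewrite ?mul0r ?mulr0.
Qed.

Lemma esum_weight_no_unary (P : rtree -> Prop) :
  \esum_(u in [set u | no_unary u /\ P u]) (weight q u)%:E =
  \esum_(u in [set u | P u]) (weight q u)%:E.
Proof.
rewrite [RHS](@esum_subset _ _ _ [set u | no_unary u /\ P u])//.
- by move=> u [].
- by move=> u _; rewrite lee_fin weight_ge0.
- move=> u Pu nu; rewrite weight_unary//; apply/negP => nu'; exact: nu.
Qed.

Definition reorderings (v : rtree) : set rtree :=
  [set u | reordering (Node [:: u]) (Node [:: v])].

Lemma gw_phi : gw q [set phi] = 0%E.
Proof.
rewrite gw_stems esum1// => u [nu /=]; rewrite /phi => /tree_eqP.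
by move/reordering_size.
Qed.

Lemma gw_tree v (nv : no_unary v) : gw q [set \pi_tree (stem nv)] =
  \esum_(u in reorderings v) (weight q u)%:E.
Proof.
rewrite gw_stems -[RHS]esum_weight_no_unary; congr esum.
apply/seteqP; split=> u [nu /=]; first by move/tree_eqP.
by move=> uv; exists nu; apply/tree_eqP.
Qed.

Hypothesis q_crit : critical q \/ subcritical q.

(** The tree is finite almost surely, and pruning reduces it to its root exactly
    when it has a single edge. *)
Lemma gw_pruned_not_phi :
  pushforward (gw q) horton_prune [set~ phi] = (1 - q 0%N)%:E.
Proof.
rewrite /pushforward gw_stems.
have w0 (u : rtree) : (0 <= (weight q u)%:E)%E by rewrite lee_fin weight_ge0.
have := esum_weight q1_eq0 q_crit; rewrite (esumID [set Node [::]])//.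
rewrite !setTI esum_set1// weight_Node big_nil mulr1 => h.
rewrite EFinB -h addeAC subee ?add0e//.
rewrite -[RHS]esum_weight_no_unary; congr esum.
apply/seteqP; split=> u [nu /=].
  by move=> np; split=> // u0; apply: np; apply/horton_prune_stem_phi.
by move=> u0; exists nu => /horton_prune_stem_phi.
Qed.

(** The passage to unlabeled trees commutes with pruning because the plane
    representatives of an unlabeled tree are grouped by their plane prunings. *)
Lemma gw_pruned_tree v (nv : no_unary v) : q 0%N < 1 ->
  pushforward (gw q) horton_prune ([set \pi_tree (stem nv)] `&` [set~ phi]) =
  ((1 - q 0%N)%:E *
    \esum_(u in reorderings v) (weight (pruned_offspring q) u)%:E)%E.
Proof.
move=> q0_lt1; rewrite /pushforward gw_stems.
rewrite (_ : [set u | _] = [set u | no_unary u /\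
    exists2 w, reorderings v w & pruned_subtree u = Some w]).
  rewrite esum_fiber; last by move=> u; rewrite lee_fin weight_ge0.
  transitivity (\esum_(u in reorderings v)
      ((1 - q 0%N)%:E * (weight (pruned_offspring q) u)%:E)%E).
    by apply: eq_esum => w _; rewrite esum_weight_no_unary -EFinM esum_pruned.
  rewrite esumZl ?subr_ge0 ?ltW// => u; rewrite lee_fin.
  exact: weight_pruned_ge0.
apply/seteqP; split=> u [nu].
  move=> [/= + np]; rewrite horton_prune_pi => /tree_eqP.
  rewrite /= prune_planted => h; split=> //; move: h.
  case: (pruned_subtree u) => [w|] h.
    by exists w.
  by have := reordering_size h.
move=> [w wv uw]; exists nu; split=> /=; rewrite horton_prune_pi.
  by apply/tree_eqP; rewrite /= prune_planted uw.
move/tree_eqP; rewrite /= prune_planted uw.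
by move/reordering_size.
Qed.

End gw_sums.

(** Invariants of reordering are stable under quantification over the children;
    two applications starting from [is_leaf] show that planted stars are alone
    in their class. *)
Lemma reordering_all_children (p : pred rtree) (n : nat) :
  (forall t u, reordering t u -> p t = p u) ->
  forall t u, reordering t u ->
    (size (children t) == n) && all p (children t) =
    (size (children u) == n) && all p (children u).
Proof.
move=> pinv t u tu; rewrite (reordering_size tu); congr (_ && _).
elim: tu => {t u} //=.
- by move=> u t v _ -> _ ->.
- by move=> s s' /perm_all ->.
- by move=> s1 t t' s2 tt' _; rewrite !all_cat /= (pinv _ _ tt').
Qed.

Definition star (m : nat) : rtree := Node (nseq m (Node [::])).

Lemma is_star m t :
  (size (children t) == m) && all is_leaf (children t) = (t == star m).
Proof.
case: t => s /=; apply/andP/eqP => [[/eqP <- sl]|[->]]; last first.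
  by rewrite size_nseq eqxx all_nseq orbT.
congr Node; apply/all_pred1P; move: sl; apply: sub_all => -[t].
by rewrite /is_leaf /= => /nilP ->.
Qed.

Lemma reorderings_star m : reorderings (star m) = [set star m].
Proof.
apply/seteqP; split=> u; last by move=> ->; exact: reordering_refl.
have leaf_inv t t' : reordering t t' -> is_leaf t = is_leaf t'.
  by rewrite /is_leaf /nilp => /reordering_size ->.
have star_inv t t' : reordering t t' -> (t == star m) = (t' == star m).
  by move=> tt'; rewrite -!is_star; exact: reordering_all_children.
move=> /(reordering_all_children 1 star_inv) /=.
by rewrite !andbT eqxx => /eqP ->.
Qed.

Lemma weight_star (R : realType) (r : nat -> R) m :
  weight r (star m) = r m * r 0%N ^+ m.
Proof.
rewrite weight_Node size_nseq; congr (_ * _).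
elim: m => [|m IH]; first by rewrite big_nil.
by rewrite big_cons IH exprS weight_Node big_nil mulr1.
Qed.

Lemma eq_weight (R : realType) (r r' : nat -> R) :
  r =1 r' -> weight r =1 weight r'.
Proof. by move=> /funext ->. Qed.

Section invariance.
Context {R : realType} (q : offspring R).
Hypothesis q1_eq0 : q 1%N = 0.
Hypothesis q_crit : critical q \/ subcritical q.

(** For the direct implication, the star with [m] leaves gives
    [p m * p 0 ^ m = q m * q 0 ^ m] where [p] is the pruned offspring law; the
    case [m = 0] identifies [p 0] with [q 0], which is positive. *)
Lemma prune_invariant_offspring : horton_prune_invariant (gw q) <->
  q 0%N < 1 /\ pruned_offspring q =1 q.
Proof.
split=> [[_]|[q0_lt1 pq]].
  rewrite gw_pruned_not_phi// lte_fin subr_gt0 => q0_lt1 inv; split=> // m.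
  have q0_gt0 : 0 < q 0%N.
    by apply: lt_le_trans (offspring_half q1_eq0 q_crit); rewrite divr_gt0.
  have star_eq k : k != 1%N -> pruned_offspring q k * pruned_offspring q 0 ^+ k
      = q k * q 0%N ^+ k.
    move=> k1; have nk : no_unary (star k).
      by rewrite /= size_nseq k1 all_nseq orbT.
    have := inv (\pi_tree (stem nk)).
    rewrite gw_pruned_tree// [RHS]gw_tree// reorderings_star.
    rewrite !esum_set1 ?lee_fin//.
    - rewrite !weight_star muleC inver subr_eq0 gt_eqF//.
      rewrite muleA -!EFinM mulVf ?mul1r; first by case.
      by rewrite subr_eq0 gt_eqF.
    - exact: weight_ge0.
    - exact: weight_pruned_ge0.
  have [->|m1] := eqVneq m 1%N; first by rewrite q1_eq0.
  have p0 : pruned_offspring q 0 = q 0%N.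
    by have := star_eq 0%N isT; rewrite !mulr1.
  have := star_eq m m1; rewrite p0 => /mulIf; apply.
  by rewrite expf_neq0// gt_eqF.
split; first exact: gw_phi.
  by rewrite gw_pruned_not_phi// lte_fin subr_gt0.
move=> t; rewrite -(reprK t); have [tE|[v nv tE]] := plane_tree_case (repr t).
  have -> : repr t = plane_phi by exact: val_inj.
  rewrite /pushforward setICr preimage_set0 measure0 mul0e.
  exact/esym/gw_phi.
have -> : repr t = stem nv by exact: val_inj.
rewrite gw_pruned_not_phi// gw_pruned_tree// [RHS]gw_tree// inver.
rewrite subr_eq0 gt_eqF// muleC muleA -EFinM mulVf ?mul1e; last first.
  by rewrite subr_eq0 gt_eqF.
by apply: eq_esum => u _; rewrite (eq_weight pq).
Qed.

End invariance.

(** * Invariance as a functional equation *)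

Section power_series.
Context {R : realType}.
Implicit Types (a b d : nat -> R) (B : R).

Lemma geometric_half_sums : sums_to (fun k => (1 / 2 : R) ^+ k) 2.
Proof.
have h : `|1 / 2 : R| < 1 by rewrite ger0_norm; lra.
split; have := @cvg_geometric_series R 1 (1 / 2) h.
rewrite (_ : 1 * (1 - 1 / 2)^-1 = 2); last by field.
by rewrite (_ : geometric 1 _ = fun k => (1 / 2) ^+ k)//;
  apply/funext => k; rewrite /= mul1r.
Qed.

(** If [d m] were negative, then for small [z > 0] the term [d m * z ^ m] would
    dominate the remainder of the series. *)
Lemma first_coef_ge0 d B m : 0 <= B -> (forall k, d k <= B) ->
  (forall k, (k < m)%N -> d k = 0) ->
  (forall z, 0 <= z < 1 -> sums_to (fun k => d k * z ^+ k) 0) -> 0 <= d m.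
Proof.
move=> B0 dB dm dz.
(* For [k > m] and [z <= 1 / 2], [z ^ k <= (2 * z) ^ m.+1 * (1 / 2) ^ k], whose
   sum over all [k] is of order [z ^ m.+1]. *)
have key z : 0 < z <= 1 / 2 -> - d m <= B * 2 ^+ m.+2 * z.
  move=> /andP[z0 z2]; have zm : 0 < z ^+ m by rewrite exprn_gt0.
  rewrite -(ler_pM2r zm).
  have h := sums_toD (sums_to_delta m (d m * z ^+ m))
    (sums_toZ (B * (2 * z) ^+ m.+1) geometric_half_sums).
  have z1 : 0 <= z < 1 by lra.
  have {}h := sums_to_le _ (dz z z1) h.
  suff : 0 <= d m * z ^+ m + B * (2 * z) ^+ m.+1 * 2.
    by rewrite exprMn !exprS => ?; lra.
  apply: h => k; have z20 : 0 <= 2 * z by lra.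
  have half0 : (0 : R) <= 1 / 2 by lra.
  have g0 : 0 <= B * (2 * z) ^+ m.+1 * (1 / 2) ^+ k.
    by apply: mulr_ge0; [apply: mulr_ge0|]; rewrite ?exprn_ge0.
  case: (ltngtP k m) g0 => [km|mk|->] g0.
  - by rewrite dm// !mul0r add0r.
  - rewrite mul0r add0r -(subnKC mk); set j := (k - m.+1)%N.
    rewrite [leRHS](_ : _ = B * (z ^+ m.+1 * (1 / 2) ^+ j)); last first.
      rewrite -mulrA; congr (_ * _); rewrite exprD mulrA -exprMn.
      by congr (_ ^+ _ * _); field.
    have zj : z ^+ j <= (1 / 2) ^+ j.
      by rewrite lerXn2r ?nnegrE//; lra.
    rewrite exprD; apply: (@le_trans _ _ (B * (z ^+ m.+1 * z ^+ j))).
      by rewrite ler_wpM2r// mulr_ge0 ?exprn_ge0 ?ltW.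
    apply: ler_wpM2l => //; apply: ler_wpM2l => //.
    by rewrite exprn_ge0 ?ltW.
  - by rewrite /= [1 * (d m * _)]mul1r lerDl.
rewrite leNgt; apply/negP => dneg.
pose C := B * 2 ^+ m.+2.
have C0 : 0 <= C by rewrite mulr_ge0 ?exprn_ge0.
have Ce : 0 < 2 * (C - d m) by lra.
(* This point is at most [1 / 2], and its product with [C] is below [- d m]. *)
have := key (- d m / (2 * (C - d m))).
rewrite divr_gt0 ?oppr_gt0//= ler_pdivrMr// -/C.
have h : 1 / 2 * (2 * (C - d m)) = C - d m by field.
rewrite h mulrA ler_pdivlMr// => {}h.
suff : - d m * (2 * (C - d m)) <= C * - d m by nra.
by apply: h; lra.
Qed.

Lemma power_series_unique a b B (s : R -> R) :
  (forall k, `|a k - b k| <= B) ->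
  (forall z, 0 <= z < 1 -> sums_to (fun k => a k * z ^+ k) (s z)) ->
  (forall z, 0 <= z < 1 -> sums_to (fun k => b k * z ^+ k) (s z)) -> a =1 b.
Proof.
move=> abB az bz m; have B0 : 0 <= B by apply: le_trans (abB 0%N).
have dz z : 0 <= z < 1 -> sums_to (fun k => (a k - b k) * z ^+ k) 0.
  move=> z01; have := sums_toB (az z z01) (bz z z01); rewrite subrr.
  by apply: sums_to_eq => k; rewrite mulrBl.
elim/ltn_ind: m => m IH.
have d0 k : (k < m)%N -> a k - b k = 0 by move=> /IH ->; rewrite subrr.
have h1 : 0 <= a m - b m.
  apply: (first_coef_ge0 B0 _ d0 dz) => k.
  exact: le_trans (ler_norm _) (abB k).
have h2 : 0 <= - (a m - b m).
  apply: (first_coef_ge0 (d := fun k => - (a k - b k)) B0) => [k|k km|z z01].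
  - by rewrite (le_trans _ (abB k))// -normrN ler_norm.
  - by rewrite d0 ?oppr0.
  - have := sums_toZ (-1) (dz z z01); rewrite mulr0; apply: sums_to_eq => k.
    by rewrite mulN1r mulNr.
by apply/eqP; rewrite eq_le; lra.
Qed.

End power_series.

Section functional_equation.
Context {R : realType} (q : offspring R).
Hypothesis q1_eq0 : q 1%N = 0.
Hypothesis q_crit : critical q \/ subcritical q.
Hypothesis q0_lt1 : q 0%N < 1.

Let c01 : 0 <= q 0%N <= 1.
Proof. by rewrite offspring_ge0 offspring_le1. Qed.

Lemma pgf_pruned : pruned_offspring q =1 q ->
  forall z, 0 <= z < 1 ->
  pgf q (q 0%N + (1 - q 0%N) * z) - (q 0%N + (1 - q 0%N) * z) =
  (1 - q 0%N - thin q (q 0%N) 1) * (pgf q z - z).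
Proof.
move=> pq z /andP[z0 z1]; have z01 : 0 <= z <= 1 by rewrite z0 ltW.
have K0 := lt0r_neq0 (thin1_lt q1_eq0 q_crit q0_lt1).
set K := (X in X != 0) in K0 *.
have h := sums_toD (sums_toD (sums_toZ K (pgf_sums q z01))
  (sums_to_delta 0%N (q 0%N))) (sums_to_delta 1%N (thin q (q 0%N) 1 * z)).
suff -> : pgf q (q 0%N + (1 - q 0%N) * z) =
    K * pgf q z + q 0%N + thin q (q 0%N) 1 * z by rewrite /K; ring.
apply: sums_to_unique (thin_pgf q c01 z01) _.
have Kq k : k != 1%N ->
    K * q k = thin q (q 0%N) k - (k == 0%N)%:R * q 0%N.
  move=> /negbTE k1; rewrite -[q k]pq /pruned_offspring k1 -/K.
  by rewrite mulrC divfK.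
apply: sums_to_eq h => k; rewrite mulrA.
case: k => [|[|k]].
- by rewrite Kq//= expr0; ring.
- by rewrite /= q1_eq0 expr1; ring.
- by rewrite Kq//=; ring.
Qed.

(** The constant [K] may be arbitrary: comparing coefficients of degree 1 forces
    [K = 1 - q 0 - thin q (q 0) 1], the normalisation in [pruned_offspring]. *)
Lemma pruned_eq (K : R) : (forall z, 0 <= z < 1 ->
  pgf q (q 0%N + (1 - q 0%N) * z) - (q 0%N + (1 - q 0%N) * z) =
  K * (pgf q z - z)) -> pruned_offspring q =1 q.
Proof.
move=> fe.
have K0 := lt0r_neq0 (thin1_lt q1_eq0 q_crit q0_lt1).
have thE : thin q (q 0%N) =1 (fun k => K * q k + (k == 0%N)%:R * q 0%N +
    (k == 1%N)%:R * (1 - q 0%N - K)).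
  apply: (power_series_unique (B := 1 + (`|K| + 1 + `|1 - q 0%N - K|))
    (s := fun z => pgf q (q 0%N + (1 - q 0%N) * z))) => [k|z|z].
  - have b1 (b : bool) (x : R) : `|b%:R * x| <= `|x|.
      by case: b; rewrite ?mul1r ?mul0r ?normr0.
    rewrite (le_trans (ler_normB _ _))// lerD//.
      by rewrite ger0_norm ?thin_ge0 ?thin_le1.
    rewrite (le_trans (ler_normD _ _))// lerD//.
    rewrite (le_trans (ler_normD _ _))// lerD//.
      by rewrite normrM ler_piMr// ger0_norm ?offspring_ge0 ?offspring_le1.
    by rewrite (le_trans (b1 _ _))// ger0_norm ?offspring_ge0 ?offspring_le1.
  - by move=> /andP[z0 z1]; apply: thin_pgf => //; rewrite z0 ltW.
  move=> z01; have z01' : 0 <= z <= 1 by case/andP: z01 => -> /ltW.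
  have h := sums_toD (sums_toD (sums_toZ K (pgf_sums q z01'))
    (sums_to_delta 0%N (q 0%N))) (sums_to_delta 1%N ((1 - q 0%N - K) * z)).
  have -> : pgf q (q 0%N + (1 - q 0%N) * z) =
      K * pgf q z + q 0%N + (1 - q 0%N - K) * z by have := fe z z01; lra.
  apply: sums_to_eq h => -[|[|k]] /=.
  + by rewrite expr0; ring.
  + by rewrite expr1; ring.
  + by ring.
move=> k; have := thE 1%N; rewrite q1_eq0 /= mulr0 mul0r mul1r !add0r => th1.
rewrite /pruned_offspring; case: eqP => [->//|k1]; rewrite thE.
move: K0; rewrite th1 (_ : _ - _ = K); last by ring.
move=> K0; move/eqP/negbTE: k1 => ->.
by rewrite /= mul0r addr0 addrK mulrC mulKf.
Qed.

End functional_equation.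

(** * The derivative of the generating function *)

Lemma sums_to_shift (R : realType) (u : nat -> R) a :
  sums_to u a -> sums_to (fun k => u k.+1) (a - u 0%N).
Proof.
move=> [ua]; split.
rewrite (_ : series _ = (fun n => series u n.+1 - u 0%N)); last first.
  by apply/funext => n; rewrite /series /= big_nat_recl//= addrAC subrr add0r.
apply: cvgB; last exact: cvg_cst.
by move: ua; rewrite -cvg_shiftS.
Qed.

Section pgf_derivative.
Context {R : realType} (q : offspring R).
Hypothesis q1_eq0 : q 1%N = 0.
Hypothesis q_crit : critical q \/ subcritical q.

Definition pgf' (z : R) : R := limn (pseries (pseries_diffs q) z).

Let shifted_mean :
  exists2 m : R, sums_to (fun k => k.+1%:R * q k.+1) m & m <= 1.
Proof.
have [m qm m1] := mean_sums q_crit; exists m => //.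
by have := sums_to_shift qm; rewrite mul0r subr0.
Qed.

Lemma pgf'_sums z : 0 <= z <= 1 ->
  sums_to (fun k => k.+1%:R * q k.+1 * z ^+ k) (pgf' z).
Proof.
move=> /andP[z0 z1]; have [m qm m1] := shifted_mean.
have [|a qa] := sums_to_dominated _ qm
    (u := fun k => k.+1%:R * q k.+1 * z ^+ k).
  move=> k; have qk0 : 0 <= k.+1%:R * q k.+1.
    by rewrite mulr_ge0 ?offspring_ge0.
  by rewrite mulr_ge0 ?exprn_ge0//= ler_piMr// exprn_ile1.
by rewrite /pgf' (sums_to_lim qa).
Qed.

Lemma pgf'_le z : 0 <= z <= 1 -> 0 <= pgf' z <= z.
Proof.
move=> /[dup] z01 /andP[z0 z1];
have [m qm m1] := shifted_mean; apply/andP; split.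
  apply: (sums_to_ge0 _ (pgf'_sums z01)) => k.
  by rewrite mulr_ge0 ?exprn_ge0// mulr_ge0 ?offspring_ge0.
apply: le_trans (_ : z * m <= z); last by rewrite ler_piMr.
apply: sums_to_le (pgf'_sums z01) (sums_toZ z qm) => -[|k].
  by rewrite q1_eq0 !(mulr0, mul0r).
rewrite mulrC ler_wpM2r//; first by rewrite mulr_ge0 ?offspring_ge0.
by rewrite exprS ler_piMr// exprn_ile1.
Qed.

(** Termwise differentiation requires the second derived series to converge;
    this bound deduces it from the finiteness of the mean. *)
Lemma natmul_expr_le (z : R) k : 0 <= z < 1 -> k.+1%:R * z ^+ k <= (1 - z)^-1.
Proof.
move=> /andP[z0 z1]; rewrite -div1r ler_pdivlMr ?subr_gt0//.
apply: (@le_trans _ _ (1 - z ^+ k.+1)); last by rewrite gerBl exprn_ge0.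
elim: k => [|k IH]; first by rewrite expr0 expr1; lra.
have zk : z ^+ k.+1 <= 1 by rewrite exprn_ile1// ltW.
have : 0 <= (1 - z) * (1 - z ^+ k.+1) by rewrite mulr_ge0 ?subr_ge0// ltW.
have := ler_wpM2l z0 IH.
rewrite -[k.+2%:R]natr1 [z ^+ k.+2]exprS.
rewrite (_ : z * (k.+1%:R * z ^+ k * (1 - z)) =
   k.+1%:R * z ^+ k.+1 * (1 - z)); last by rewrite exprS; ring.
by lra.
Qed.

Lemma is_derive_pgf (z : R) : 0 <= z < 1 -> is_derive z 1 (pgf q) (pgf' z).
Proof.
move=> /andP[z0 z1]; pose K : R := (1 + z) / 2.
have K1 : K < 1 by rewrite /K; lra.
have zK : z < K by rewrite /K; lra.
have K01 : 0 <= K <= 1 by lra.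
have cvgs (u : nat -> R) a : sums_to u a -> cvgn (series u).
  by move=> [ua]; apply/cvg_ex; exists a.
apply: (@pseries_snd_diffs R q K z).
- exact: cvgs (pgf_sums q K01).
- exact: cvgs (pgf'_sums K01).
- have [m qm m1] := shifted_mean.
  have [|a] := sums_to_dominated _ (sums_toZ (1 - K)^-1 (sums_to_shift qm))
      (u := fun k => k.+1%:R * (k.+2%:R * q k.+2) * K ^+ k); last exact: cvgs.
  move=> k; have qk0 : 0 <= k.+2%:R * q k.+2 by rewrite mulr_ge0 ?offspring_ge0.
  rewrite mulr_ge0 ?exprn_ge0 ?(mulr_ge0 _ qk0)//=; last by case/andP: K01.
  by rewrite mulrAC ler_wpM2r// natmul_expr_le//; lra.
- by rewrite !ger0_norm; lra.
Qed.

Lemma derive1_pgf (z : R) : 0 <= z < 1 -> derive1 (pgf q) z = pgf' z.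
Proof. by move=> /is_derive_pgf[_ <-]; rewrite derive1E. Qed.

(** The coefficient of degree 1 of [Q (c + (1 - c) z)]. *)
Lemma thin1_pgf' : q 0%N < 1 ->
  thin q (q 0%N) 1 = (1 - q 0%N) * pgf' (q 0%N).
Proof.
move=> q0_lt1; have c01 : 0 <= q 0%N <= 1 by rewrite offspring_ge0 ltW.
have h1 := sums_to_shift (thin_sums q c01 1).
have h2 := sums_toZ (1 - q 0%N) (pgf'_sums c01).
rewrite /binom_mass bin0n !(mul0r, mulr0, subr0) in h1.
apply: sums_to_unique h1 _; apply: sums_to_eq h2 => k.
by rewrite bin1 subn1 expr1 /=; ring.
Qed.

End pgf_derivative.

(** * Rigidity: a limit at 1 excludes oscillating solutions *)

(** The iterates of [z |-> c + (1 - c) z] tend to 1, so the value at [z] is the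
    limit at 1. *)
Lemma affine_invariant_const (R : realType) (f : R -> R) (c L : R) :
  0 < c < 1 -> (forall z, 0 <= z < 1 -> f (c + (1 - c) * z) = f z) ->
  f x @[x --> 1^'-] --> L -> forall z, 0 <= z < 1 -> f z = L.
Proof.
move=> /andP[c0 c1] fc /cvg_at_leftP fL z /andP[z0 z1].
pose u n := 1 - (1 - c) ^+ n * (1 - z).
have c1' : 0 < 1 - c by rewrite subr_gt0.
have u01 n : 0 <= u n < 1.
  have d0 : 0 < (1 - c) ^+ n * (1 - z) by rewrite mulr_gt0 ?exprn_gt0 ?subr_gt0.
  have d1 : (1 - c) ^+ n * (1 - z) <= 1.
    by rewrite mulr_ile1 ?exprn_ge0 ?exprn_ile1//; lra.
  by rewrite /u; lra.
have uS n : u n.+1 = c + (1 - c) * u n by rewrite /u exprS; ring.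
have fu n : f (u n) = f z.
  elim: n => [|n IH]; first by rewrite /u expr0; congr f; ring.
  by rewrite uS fc.
have : (fun n => f (u n)) @ \oo --> L.
  apply: fL; split=> [n|]; first by have /andP[] := u01 n.
  rewrite -[X in _ --> X]subr0 -(mul0r (1 - z)).
  apply: cvgB; first exact: cvg_cst.
  apply: cvgM; last exact: cvg_cst.
  by apply: cvg_expr; rewrite ger0_norm; lra.
rewrite (_ : (fun n => _) = cst (f z)); last exact/funext.
by move/cvg_lim => <-//; rewrite lim_cst.
Qed.

Lemma affine_itv (R : realType) (c z : R) :
  0 <= c < 1 -> 0 <= z < 1 -> 0 <= c + (1 - c) * z < 1.
Proof.
move=> /andP[c0 c1] /andP[z0 z1]; apply/andP; split.
  by rewrite addr_ge0 ?mulr_ge0 ?subr_ge0// ltW.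
have : 0 < (1 - c) * (1 - z) by rewrite mulr_gt0 ?subr_gt0.
by lra.
Qed.

Section rigidity.
Context {R : realType} (q : offspring R).
Hypothesis q1_eq0 : q 1%N = 0.
Hypothesis q_crit : critical q \/ subcritical q.
Hypothesis q0_lt1 : q 0%N < 1.

Let q0_gt0 : 0 < q 0%N.
Proof.
by apply: lt_le_trans (offspring_half q1_eq0 q_crit); rewrite divr_gt0.
Qed.

Let D (z : R) := pgf q z - z.
Let D' (z : R) := pgf' q z - 1.

Let is_derive_D (z : R) : 0 <= z < 1 -> is_derive z 1 D (D' z).
Proof.
move=> z01; have := is_derive_pgf q_crit z01 => dQ.
exact: is_deriveB.
Qed.

Let D'_lt0 z : 0 <= z < 1 -> D' z < 0.
Proof.
move=> /[dup] z01 /andP[z0 z1]; have z01' : 0 <= z <= 1 by rewrite z0 ltW.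
have /andP[_ h] := pgf'_le q1_eq0 q_crit z01'; rewrite /D'; lra.
Qed.

Let h z := D z / ((1 - z) * - D' z).

Let S_of_ratio z : 0 <= z < 1 -> (1 - S_of q z) / (1 - z) = 1 - h z.
Proof.
move=> /[dup] z01 /andP[z0 z1]; rewrite /S_of derive1_pgf// /h.
have := D'_lt0 z01; rewrite /D' /D => d0.
field; rewrite lt_eqF// !gt_eqF// subr_gt0//; lra.
Qed.

Hypothesis pq : pruned_offspring q =1 q.

Let D0 : D 0 = q 0%N.
Proof. by rewrite /D subr0 pgf0. Qed.

Let D'0 : D' 0 = -1.
Proof.
have /andP[a b] : 0 <= pgf' q 0 <= 0 by apply: pgf'_le; rewrite ?lexx ?ler01.
by rewrite /D'; lra.
Qed.

Let phi01 z : 0 <= z < 1 -> 0 <= q 0%N + (1 - q 0%N) * z < 1.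
Proof. by apply: affine_itv; rewrite ltW. Qed.

(** By the functional equation and its derivative, [D] and [(1 - z) D'] are both
    multiplied by [K].  At [z = 0], where the functional equation holds on
    one side only, the relation between the derivatives is the identity
    [K = (1 - c) (1 - Q'(c))] with [c = q 0]. *)
Let h_invariant z : 0 <= z < 1 -> h (q 0%N + (1 - q 0%N) * z) = h z.
Proof.
move=> /[dup] z01 /andP[z0 z1].
pose K := 1 - q 0%N - thin q (q 0%N) 1.
have K0 : 0 < K := thin1_lt q1_eq0 q_crit q0_lt1.
have fe := pgf_pruned q1_eq0 q_crit q0_lt1 pq.
have D'E : (1 - q 0%N) * D' (q 0%N + (1 - q 0%N) * z) = K * D' z.
  have [z00|zpos] := eqVneq z 0.
    by rewrite z00 mulr0 addr0 D'0 /K thin1_pgf'// /D'; ring.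
  have d1 : is_derive z 1 (fun x => D (q 0%N + (1 - q 0%N) * x))
      (D' (q 0%N + (1 - q 0%N) * z) * (1 - q 0%N)).
    apply: is_derive1_comp; first exact: is_derive_D (phi01 z01).
    by apply: is_derive_eq; rewrite add0r mul1r /GRing.scale /= mulr1.
  have d2 : is_derive z 1 (fun x => K * D x) (K * D' z).
    exact: is_deriveZ (is_derive_D z01).
  have e : \near z, K * D z = D (q 0%N + (1 - q 0%N) * z).
    have : \forall x \near z, x \in `]0, 1[.
      by apply: near_in_itvoo; rewrite in_itv /= z1 lt_def zpos z0.
    apply: filterS => x; rewrite in_itv /= => /andP[x0 x1].
    by rewrite /D fe// ltW.
  have [_ d2E] := near_eq_is_derive e d2; have [_ d1E] := d1.
  by rewrite mulrC -d1E -d2E.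
rewrite /h /D fe// -/K -/(D z).
have d0 := D'_lt0 z01; have d1 := D'_lt0 (phi01 z01).
rewrite (_ : (1 - (q 0%N + (1 - q 0%N) * z)) * - D' (q 0%N + (1 - q 0%N) * z)
  = K * ((1 - z) * - D' z)); last by nra.
by field; rewrite lt_eqF// !gt_eqF// subr_gt0.
Qed.

Hypothesis S'1_exists : cvg ((fun x : R => (1 - S_of q x) / (1 - x)) @ 1^'-).

Let h_const z : 0 <= z < 1 -> h z = q 0%N.
Proof.
have := @affine_invariant_const R (fun x => (1 - S_of q x) / (1 - x)) (q 0%N)
  (lim ((fun x : R => (1 - S_of q x) / (1 - x)) @ 1^'-)).
set L := lim _ => H.
have {}H x : 0 <= x < 1 -> 1 - h x = L.
  move=> x01; rewrite -S_of_ratio//; apply: H => //.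
    by rewrite q0_gt0.
  by move=> y y01; rewrite !S_of_ratio ?phi01// h_invariant.
move=> z01; have := H z z01; have := H 0; rewrite lexx ltr01 => /(_ isT) <-.
suff -> : h 0 = q 0%N by lra.
by rewrite /h D0 D'0; field.
Qed.

(** Since [h] is the constant [q 0], [D] solves [D = - q 0 (1 - z) D'], so that
    [D z * (1 - z) `^ (- 1 / q 0)] has derivative 0. *)
Lemma pgf_closed_form z : 0 <= z < 1 ->
  pgf q z = z + q 0%N * (1 - z) `^ (q 0%N)^-1.
Proof.
move=> /andP[z0 z1]; pose e := (q 0%N)^-1.
have ode x : 0 <= x < 1 -> D x = q 0%N * ((1 - x) * - D' x).
  move=> /[dup] x01 /andP[_ x1]; rewrite -(h_const x01) /h divfK//.
  by rewrite mulf_neq0// ?gt_eqF ?oppr_gt0 ?D'_lt0 ?subr_gt0.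
pose E x := expR (e * - ln (1 - x)).
have dE (x : R) : x < 1 -> is_derive x 1 E (E x * (e * (1 - x)^-1)).
  move=> x1; have x0 : 0 < 1 - x by rewrite subr_gt0.
  have dln : is_derive x 1 (fun x => ln (1 - x)) ((1 - x)^-1 * -1).
    have dg : is_derive x 1 (fun x : R => 1 - x) (-1).
      by apply: is_derive_eq; rewrite add0r mul1r.
    exact: (@is_derive1_comp R (@ln R) (fun x : R => 1 - x) x _ _
      (is_derive1_ln x0) dg).
  have dexp : is_derive x 1 (fun x => e * - ln (1 - x)) (e * (1 - x)^-1).
    rewrite (_ : e * (1 - x)^-1 = e *: - ((1 - x)^-1 * -1)).
      apply: is_deriveZ; exact: is_deriveN.
    by rewrite mulrN1 opprK.
  exact: (@is_derive1_comp R (@expR R) _ x _ _ (is_derive_expR _) dexp).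
have dF (x : R) : 0 <= x < 1 -> is_derive x 1 (fun x => D x * E x) 0.
  move=> /[dup] x01 /andP[x0 x1].
  apply: (is_derive_eq (is_deriveM (is_derive_D x01) (dE _ x1))).
  rewrite /GRing.scale /= (ode x x01) /e; field.
  by rewrite !gt_eqF ?subr_gt0.
have [x||c _] := @MVT_segment R (fun x => D x * E x) (fun=> 0) 0 z z0.
- rewrite in_itv /= => /andP[x0 x1]; apply: dF.
  by rewrite ltW//= (lt_trans x1).
- apply: derivable_within_continuous => x; rewrite in_itv /= => /andP[x0 x1].
  have [] := dF x; last by [].
  by rewrite x0 (le_lt_trans x1).
rewrite mul0r D0 /E subr0 ln1 oppr0 mulr0 expR0 mulr1 => /eqP.
rewrite subr_eq0 => /eqP FE.
have Dz : D z = q 0%N * expR (e * ln (1 - z)).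
  by rewrite -FE -mulrA -expRD -mulrDr addNr mulr0 expR0 mulr1.
rewrite /powR gt_eqF ?subr_gt0// -/e -Dz /D; ring.
Qed.

End rigidity.

(** * Invariant Galton-Watson laws are critical *)

Section igw.
Context {R : realType} (q : offspring R).
Hypothesis q_crit : critical q \/ subcritical q.

(** Bernoulli's inequality, averaged over [q]. *)
Lemma mean_lower m z : sums_to (fun k => k%:R * q k) m -> 0 <= z <= 1 ->
  1 - pgf q z <= (1 - z) * m.
Proof.
move=> qm z01.
apply: sums_to_le (sums_toB (offspring_sums q) (pgf_sums q z01))
  (sums_toZ (1 - z) qm) => k.
suff h : 1 - z ^+ k <= (1 - z) * k%:R.
  by have := ler_wpM2r (offspring_ge0 q k) h; lra.
case/andP: z01 => z0 z1; elim: k => [|k IH]; first by rewrite expr0; lra.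
have : 0 <= (1 - z) * (1 - z ^+ k).
  by rewrite mulr_ge0 ?subr_ge0 ?exprn_ile1.
by rewrite exprS -natr1; lra.
Qed.

(** As [z] tends to 1 the slope [(1 - Q z) / (1 - z)] tends to 1, and it is
    bounded by the mean. *)
Lemma igw_critical (c : R) : 0 < c < 1 ->
  (forall z, 0 <= z < 1 -> pgf q z = z + c * (1 - z) `^ c^-1) -> critical q.
Proof.
move=> /andP[c0 c1] Qz; have [m qm m1] := mean_sums q_crit.
have mE : mean q = m%:E.
  apply/nneseries_sums_to => // k.
  by rewrite mulr_ge0 ?offspring_ge0.
have m0 : 0 <= m.
  by apply: (sums_to_ge0 _ qm) => k; rewrite mulr_ge0 ?offspring_ge0.
rewrite /critical mE; congr EFin; apply/eqP; rewrite eq_le m1 /= leNgt.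
apply/negP => mlt1; pose d := 1 - m.
have d0 : 0 < d by rewrite subr_gt0.
pose a := c^-1 - 1; have a0 : 0 < a by rewrite subr_gt0 invf_gt1.
(* With [z = 1 - y] the slope is [1 - c * y `^ a = 1 - c * d > 1 - d = m]. *)
pose y := d `^ a^-1.
have y0 : 0 < y by rewrite powR_gt0.
have y1 : y <= 1.
  apply: (@le_trans _ _ (1 `^ a^-1)); last by rewrite powR1.
  have d1 : d <= 1 by rewrite gerBl.
  by rewrite ge0_ler_powR ?nnegrE ?invr_ge0//; exact: ltW.
have ya : y `^ c^-1 = d * y.
  rewrite -[c^-1](subrK 1) -/a powRD; last by rewrite (gt_eqF y0) implybT.
  by rewrite (powRr1 (ltW y0)) /y -powRrM mulVf ?gt_eqF// powRr1 ?ltW.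
have z01 : 0 <= 1 - y < 1 by lra.
have z01' : 0 <= 1 - y <= 1 by lra.
have yE : 1 - (1 - y) = y by ring.
have := mean_lower qm z01'; rewrite Qz// yE ya.
rewrite (_ : 1 - _ = y * (1 - c * d)); last by ring.
rewrite ler_pM2l// => h.
have : 0 < d * (1 - c) by rewrite mulr_gt0 ?subr_gt0.
by rewrite /d; rewrite /d in h; lra.
Qed.

End igw.

Theorem theorem2 (R : realType) (q : offspring R)
    (q1_eq0 : q 1%N = 0)
    (q_crit : critical q \/ subcritical q)
    (S'1_exists : cvg ((fun x : R => (1 - S_of q x) / (1 - x)) @ 1^'-)) :
  horton_prune_invariant (gw q) <->
  (1 / 2 <= q 0%N < 1 /\ is_IGW (q 0%N) (gw q)).
Proof.
split=> [/(prune_invariant_offspring q1_eq0 q_crit)[q0_lt1 pq]|].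
  have q0_half := offspring_half q1_eq0 q_crit.
  have Qz := pgf_closed_form q1_eq0 q_crit q0_lt1 pq S'1_exists.
  split; first by rewrite q0_half.
  exists q; split=> //; apply: igw_critical Qz => //.
  by rewrite q0_lt1 andbT; lra.
move=> [/andP[q0_half q0_lt1] [p [p1 p_crit Pz gwE]]].
have p0 : p 0%N = q 0%N.
  have z01 : 0 <= (0 : R) < 1 by rewrite lexx ltr01.
  by rewrite -(pgf0 p) Pz// subr0 powR1 add0r mulr1.
have pinv : horton_prune_invariant (gw p).
  apply/prune_invariant_offspring => //; first by left.
  have p0_lt1 : p 0%N < 1 by rewrite p0.
  split=> //.
  apply: (pruned_eq p1 (or_introl p_crit) p0_lt1
    (K := (1 - q 0%N) `^ (q 0%N)^-1)).
  move=> z /[dup] z01 /andP[z0 z1]; rewrite p0 !Pz//; last first.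
    by apply: affine_itv => //; lra.
  rewrite (_ : 1 - (q 0%N + (1 - q 0%N) * z) = (1 - q 0%N) * (1 - z)).
    by rewrite powRM ?subr_ge0 ?ltW//; ring.
  by ring.
case: pinv => phi0 pos inv; split=> [||t]; rewrite /pushforward !gwE //.
exact: inv.
Qed.
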